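(* Let $(\Omega,\Sigma,\mu)$ be a probability space, let $Y$ be a Banach space and let $G\in L(L_1(\mu),Y)$ be a norm-one operator. The following assertions are equivalent: (i) $G$ has the alternative Daugavet property. (ii) For every $A\in\Sigma$ with $\mu(A)>0$, the set $G(\Gamma_A)$ is a spear set of $Y$, where $\Gamma_A=\left\{\mathbf{1}_B/\mu(B): B\in\Sigma,\ B\subset A,\ \mu(B)>0\right\}\subset L_1(\mu)$. (iii) $\sup_{\omega\in\mathbb{T}}\|G+\omega T\|=1+\|T\|$ for every (Riesz) representable operator $T\in L(L_1(\mu),Y)$.
   Context: Scalars are $\mathbb{K}=\mathbb{R}$ or $\mathbb{C}$; $\mathbb{T}=\{\omega\in\mathbb{K}:|\omega|=1\}$; $B_Y$ is the closed unit ball of $Y$. An operator $G\in L(X,Y)$ has the alternative Daugavet property (aDP) if $\sup_{\omega\in\mathbb{T}}\|G+\omega T\|=1+\|T\|$ for every rank-one $T\in L(X,Y)$. A set $F\subset B_Y$ is a spear set if $\sup\{\|z+\omega y\|: z\in F,\ \omega\in\mathbb{T}\}=1+\|y\|$ for every $y\in Y$. An operator $T\in L(L_1(\mu),Y)$ is (Riesz) representable if there is a strongly measurable, essentially bounded $g\in L_\infty(\mu,Y)$ with $T(f)=\int_\Omega f g\,d\mu$ for all $f\in L_1(\mu)$. *)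

(* Defs.v *)
From HB Require Import structures.
From mathcomp Require Import all_boot all_order all_algebra.
From mathcomp Require Import all_classical all_reals all_analysis.
From mathcomp Require Import measurable_realfun ess_sup_inf complex.

Set Implicit Arguments.
Unset Strict Implicit.
Unset Printing Implicit Defensive.

Import Order.TTheory GRing.Theory Num.Theory.
Import numFieldNormedType.Exports.

Local Open Scope classical_set_scope.
Local Open Scope ring_scope.

Variant scalar_kind := RealScalars | ComplexScalars.

Definition scalar_field (R : realType) (k : scalar_kind) : numFieldType :=
  match k with RealScalars => R | ComplexScalars => R[i] end.

Section scalar_field.
Context {R : realType} {k : scalar_kind}.
Local Notation K := (scalar_field R k).

Definition re : K -> R :=
  match k return scalar_field R k -> R with
  | RealScalars => id
  | ComplexScalars => @complex.Re R
  end.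

Definition im : K -> R :=
  match k return scalar_field R k -> R with
  | RealScalars => cst 0
  | ComplexScalars => @complex.Im R
  end.

Definition of_real : R -> K :=
  match k return R -> scalar_field R k with
  | RealScalars => id
  | ComplexScalars => real_complex R
  end.

Lemma reD z w : re (z + w) = re z + re w.
Proof. by rewrite /re; case: k z w => //= -[a b] [c d]. Qed.

Lemma imD z w : im (z + w) = im z + im w.
Proof. by rewrite /im; case: k z w => [a b|[a b] [c d]] //=; rewrite addr0. Qed.

Lemma reM z w : re (z * w) = re z * re w - im z * im w.
Proof.
by rewrite /re /im; case: k z w => [a b|[a b] [c d]] //=; rewrite mulr0 subr0.
Qed.

Lemma imM z w : im (z * w) = re z * im w + im z * re w.
Proof.
rewrite /re /im; case: k z w => [a b|[a b] [c d]] //=.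
by rewrite mulr0 mul0r addr0.
Qed.

Lemma re0 : re 0 = 0. Proof. by rewrite /re; case: k. Qed.
Lemma im0 : im 0 = 0. Proof. by rewrite /im; case: k. Qed.

Lemma re_of_real r : re (of_real r) = r.
Proof. by rewrite /re /of_real; case: k. Qed.

Lemma im_of_real r : im (of_real r) = 0.
Proof. by rewrite /im /of_real; case: k. Qed.

Lemma of_real0 : of_real 0 = 0. Proof. by rewrite /of_real; case: k. Qed.

Lemma of_realD a b : of_real (a + b) = of_real a + of_real b.
Proof. by rewrite /of_real; case: k => //=; rewrite rmorphD. Qed.

Lemma of_realM a b : of_real (a * b) = of_real a * of_real b.
Proof. by rewrite /of_real; case: k => //=; rewrite rmorphM. Qed.

Lemma of_real_inj : injective of_real.
Proof. by move=> a b /(congr1 re); rewrite !re_of_real. Qed.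

Lemma ler_of_real a b : (of_real a <= of_real b) = (a <= b).
Proof. by rewrite /of_real; case: k => //=; exact: lecR. Qed.

Lemma of_real_norm (z : K) : of_real (re `|z|) = `|z|.
Proof. by rewrite /re /of_real; case: k z. Qed.

End scalar_field.

(* The norm of a normed space over [scalar_field R k] takes its values in the field
   of scalars; [rnorm] is the same norm with values in R. *)
Definition rnorm (R : realType) (k : scalar_kind)
  (V : normedZmodType (scalar_field R k)) (v : V) : R := re `|v|.


Section rnorm.
Context (R : realType) (k : scalar_kind).
Local Notation K := (scalar_field R k).

Lemma of_real_rnorm (V : normedZmodType K) (v : V) : of_real (rnorm v) = `|v|.
Proof. by have := of_real_norm `|v|; rewrite normr_id. Qed.

Lemma rnorm_ge0 (V : normedZmodType K) (v : V) : 0 <= rnorm v.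
Proof. by rewrite -(ler_of_real (k := k)) of_real_rnorm of_real0. Qed.

Lemma rnormD (V : normedZmodType K) (v w : V) :
  rnorm (v + w) <= rnorm v + rnorm w.
Proof.
by rewrite -(ler_of_real (k := k)) of_realD !of_real_rnorm ler_normD.
Qed.

Lemma rnorm_eq0 (V : normedZmodType K) (v : V) : rnorm v = 0 -> v = 0.
Proof.
move=> v0; apply/eqP; rewrite -normr_eq0 -of_real_rnorm v0.
by rewrite of_real0.
Qed.

Lemma rnormM (a b : K) : rnorm (a * b) = rnorm a * rnorm b.
Proof.
by apply: (@of_real_inj _ k); rewrite of_realM !of_real_rnorm normrM.
Qed.

Lemma rnormE (z : K) : rnorm z = Num.sqrt (re z ^+ 2 + im z ^+ 2).
Proof.
rewrite /rnorm /re /im; case: k z => /= z; last first.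
  exact: (congr1 (@complex.Re R) (normc_def z)).
by rewrite expr0n addr0 sqrtr_sqr.
Qed.

Lemma rnorm_le (z : K) : rnorm z <= `|re z| + `|im z|.
Proof.
rewrite rnormE -(@ler_pXn2r _ 2) ?nnegrE ?sqrtr_ge0 ?addr_ge0//.
rewrite sqr_sqrtr ?addr_ge0 ?sqr_ge0// sqrrD !real_normK ?num_real//.
by rewrite addrAC lerDl mulrn_wge0 ?mulr_ge0.
Qed.

End rnorm.


Section L1.
Context (R : realType) (k : scalar_kind) d (T : measurableType d).
Variable mu : {measure set T -> \bar R}.
Local Notation K := (scalar_field R k).

(* [Lfun mu 1] and [LspaceType] are restricted to real-valued functions, and the
   latter carries no vector space structure; hence the construction of the
   normed space [L1 k mu] of classes of K-valued integrable functions. *)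
Definition integrable_scalar : {pred T -> K} :=
  [pred f : T -> K | (re \o f \in Lfun mu 1) && (im \o f \in Lfun mu 1)].

Lemma integrable_scalar_submod : submod_closed integrable_scalar.
Proof.
have [L0 L] := Lfun_submod_closed mu (lexx (1 : \bar R)%E).
split.
  rewrite inE/= (_ : re \o 0 = 0); last by apply/funext => x /=; exact: re0.
  by rewrite (_ : im \o 0 = 0) ?L0//; apply/funext => x /=; exact: im0.
move=> a f g /andP[/= rf imf] /andP[/= rg img]; apply/andP; split => /=.
- rewrite (_ : _ \o _ = (fun x =>
      re a * re (f x) + (- im a * im (f x) + re (g x)))).
    by apply: (L (re a) (re \o f)) => //; apply: (L (- im a) (im \o f) (re \o g)).
  by apply/funext => x; rewrite /= reD reM mulNr addrA.
- rewrite (_ : _ \o _ = (fun x =>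
      re a * im (f x) + (im a * re (f x) + im (g x)))).
    by apply: (L (re a) (im \o f)) => //; apply: (L (im a) (re \o f) (im \o g)).
  by apply/funext => x; rewrite /= imD imM addrA.
Qed.

HB.instance Definition _ := GRing.isSubmodClosed.Build _ _ integrable_scalar
  integrable_scalar_submod.

Record L1fun := MkL1fun {
  L1fun_val :> T -> K;
  _ : L1fun_val \in integrable_scalar }.

HB.instance Definition _ := [isSub for L1fun_val].
HB.instance Definition _ := [Choice of L1fun by <:].
HB.instance Definition _ := [SubChoice_isSubLmodule of L1fun by <:].

Definition L1_eq (f g : L1fun) : bool :=
  `[< (f : T -> K) = (g : T -> K) %[ae mu] >].

Let L1_eq_refl : reflexive L1_eq.
Proof. by move=> f; apply/asboolP; exact: ae_eq_refl. Qed.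

Let L1_eq_sym : symmetric L1_eq.
Proof. by move=> f g; apply/idP/idP => /asboolP h; apply/asboolP/ae_eq_sym. Qed.

Let L1_eq_trans : transitive L1_eq.
Proof.
by move=> g f h /asboolP fg /asboolP gh; apply/asboolP/(ae_eq_trans fg gh).
Qed.

Canonical L1_equiv := EquivRel L1_eq L1_eq_refl L1_eq_sym L1_eq_trans.

Local Open Scope quotient_scope.

Definition L1 : Type := {eq_quot L1_eq}.
HB.instance Definition _ := Choice.on L1.
HB.instance Definition _ := EqQuotient.on L1.

Definition L1_repr (f : L1) : T -> K := L1fun_val (repr f).
Coercion L1_repr : L1 >-> Funclass.

Lemma L1_piP (f g : L1fun) :
  \pi_L1 f = \pi_L1 g <-> (f : T -> K) = (g : T -> K) %[ae mu].
Proof.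
by split=> [/eqP|fg]; [rewrite eqmodE => /asboolP|
  apply/eqP; rewrite eqmodE; apply/asboolP].
Qed.

Lemma L1_reprP (f : L1fun) : L1_repr (\pi_L1 f) = (f : T -> K) %[ae mu].
Proof. by apply/L1_piP; rewrite reprK. Qed.

Let pi_ind (P : L1 -> Prop) : (forall f, P (\pi_L1 f)) -> forall f, P f.
Proof. by move=> Ppi f; rewrite -[f]reprK. Qed.

Definition L1_add (f g : L1) : L1 := \pi_L1 (repr f + repr g).
Definition L1_opp (f : L1) : L1 := \pi_L1 (- repr f).
Definition L1_scale (a : K) (f : L1) : L1 := \pi_L1 (a *: repr f).

Lemma L1_piD f g : \pi_L1 (f + g) = L1_add (\pi_L1 f) (\pi_L1 g).
Proof.
apply/L1_piP; move: (L1_reprP f) (L1_reprP g); rewrite /L1_repr.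
apply: filterS2 => x fx gx _.
by rewrite -[LHS]/(f x + g x) -(fx I) -(gx I).
Qed.

Lemma L1_piN f : \pi_L1 (- f) = L1_opp (\pi_L1 f).
Proof.
apply/L1_piP; move: (L1_reprP f); rewrite /L1_repr.
by apply: filterS => x fx _; rewrite -[LHS]/(- f x) -(fx I).
Qed.

Lemma L1_piZ a f : \pi_L1 (a *: f) = L1_scale a (\pi_L1 f).
Proof.
apply/L1_piP; move: (L1_reprP f); rewrite /L1_repr.
by apply: filterS => x fx _; rewrite -[LHS]/(a *: f x) -(fx I).
Qed.

Let L1_addA : associative L1_add.
Proof.
by do 3!elim/pi_ind => ?; rewrite -!L1_piD addrA.
Qed.

Let L1_addC : commutative L1_add.
Proof. by do 2!elim/pi_ind => ?; rewrite -!L1_piD addrC. Qed.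

Let L1_add0 : left_id (\pi_L1 0) L1_add.
Proof. by elim/pi_ind => ?; rewrite -!L1_piD add0r. Qed.

Let L1_addN : left_inverse (\pi_L1 0) L1_opp L1_add.
Proof. by elim/pi_ind => ?; rewrite -L1_piN -L1_piD addNr. Qed.

HB.instance Definition _ :=
  GRing.isZmodule.Build L1 L1_addA L1_addC L1_add0 L1_addN.

Let L1_scaleA a b f : L1_scale a (L1_scale b f) = L1_scale (a * b) f.
Proof. by elim/pi_ind: f => f; rewrite -!L1_piZ scalerA. Qed.

Let L1_scale1 : left_id 1 L1_scale.
Proof. by elim/pi_ind => f; rewrite -L1_piZ scale1r. Qed.

Let L1_scaleDr : right_distributive L1_scale +%R.
Proof.
move=> a; do 2!elim/pi_ind => ?.
by rewrite /GRing.add/= -L1_piD -!L1_piZ -L1_piD scalerDr.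
Qed.

Let L1_scaleDl f : {morph L1_scale^~ f : a b / a + b}.
Proof.
move=> a b; elim/pi_ind: f => f.
by rewrite [in RHS]/GRing.add/= -!L1_piZ -L1_piD scalerDl.
Qed.

HB.instance Definition _ := GRing.Zmodule_isLmodule.Build K L1
  L1_scaleA L1_scale1 L1_scaleDr L1_scaleDl.

Definition L1_norm (f : L1) : R := fine (\int[mu]_x (rnorm (f x))%:E)%E.

Lemma measurable_L1fun (f : L1fun) :
  measurable_fun setT (re \o f) /\ measurable_fun setT (im \o f).
Proof.
by case: f => f /= /andP[/= /andP[+ _] /andP[+ _]]; rewrite !inE.
Qed.

Lemma measurable_rnorm (f : L1fun) : measurable_fun setT (fun x => rnorm (f x)).
Proof.
have [rf imf] := measurable_L1fun f.
rewrite (_ : (fun x => _) = (fun x => (re (f x) ^+ 2 + im (f x) ^+ 2) `^ 2^-1)).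
  apply: (measurableT_comp (measurable_powR _)).
  by apply: measurable_funD; exact: (measurable_funX 2).
by apply/funext => x; rewrite rnormE powR12_sqrt// addr_ge0 ?sqr_ge0.
Qed.

Lemma integrable_rnorm (f : L1fun) :
  mu.-integrable setT (fun x => (rnorm (f x))%:E).
Proof.
case: (f) (measurable_rnorm f) => {}f fL /= mf.
have /andP[/Lfun1_integrable rf /Lfun1_integrable imf] := fL.
apply: (le_integrable _ _ _ (integrableD _ (integrable_abse rf)
  (integrable_abse imf))) => //.
  exact/measurable_EFinP.
move=> x _ /=; rewrite lee_fin ger0_norm ?rnorm_ge0//.
by rewrite ger0_norm ?addr_ge0// rnorm_le.
Qed.

Lemma L1_norm_pi f : (L1_norm (\pi_L1 f))%:E = (\int[mu]_x (rnorm (f x))%:E)%E.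
Proof.
rewrite /L1_norm fineK; last first.
  exact: integrable_fin_num (integrable_rnorm _).
apply: ge0_ae_eq_integral => //.
- exact/measurable_EFinP/measurable_rnorm.
- exact/measurable_EFinP/measurable_rnorm.
- by move=> x _; rewrite lee_fin rnorm_ge0.
- by move=> x _; rewrite lee_fin rnorm_ge0.
- by apply: filterS (L1_reprP f) => x fx _; rewrite fx.
Qed.

Let L1_normD f g : of_real (k := k) (L1_norm (f + g)) <=
  of_real (L1_norm f) + of_real (L1_norm g).
Proof.
rewrite -of_realD ler_of_real; elim/pi_ind: f => f; elim/pi_ind: g => g.
rewrite [in leLHS]/GRing.add/= -L1_piD -lee_fin EFinD !L1_norm_pi.
rewrite -ge0_integralD//.
- apply: ge0_le_integral => //.
  + by move=> x _; rewrite lee_fin rnorm_ge0.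
  + exact/measurable_EFinP/measurable_rnorm.
  + by apply: emeasurable_funD; exact/measurable_EFinP/measurable_rnorm.
  + by move=> x _; rewrite -EFinD lee_fin; exact: rnormD.
- by move=> x _; rewrite lee_fin rnorm_ge0.
- exact/measurable_EFinP/measurable_rnorm.
- by move=> x _; rewrite lee_fin rnorm_ge0.
- exact/measurable_EFinP/measurable_rnorm.
Qed.

Let L1_normZ (a : K) f : of_real (k := k) (L1_norm (a *: f)) =
  `|a| * of_real (L1_norm f).
Proof.
rewrite -[`|a|]of_real_norm -of_realM; congr of_real.
elim/pi_ind: f => f; rewrite [X in L1_norm X]/GRing.scale/= -L1_piZ.
apply: EFin_inj; rewrite EFinM !L1_norm_pi.
rewrite -ge0_integralZl//.
- apply: eq_integral => x _; rewrite -EFinM -(rnormM a (f x)).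
  by congr (rnorm _)%:E.
- exact/measurable_EFinP/measurable_rnorm.
- by move=> x _; rewrite lee_fin rnorm_ge0.
- by rewrite lee_fin (rnorm_ge0 (V := K)).
Qed.

Let L1_norm_eq0 f : of_real (k := k) (L1_norm f) = 0 -> f = 0.
Proof.
rewrite -of_real0 => /of_real_inj; elim/pi_ind: f => f f0.
rewrite [RHS]/GRing.zero/=; apply/L1_piP.
have : (\int[mu]_x (rnorm (f x))%:E)%E = 0 by rewrite -L1_norm_pi f0.
under eq_integral do rewrite -[(rnorm _)%:E]gee0_abs ?lee_fin ?rnorm_ge0//.
move/ae_eq_integral_abs => /(_ measurableT).
have mf : measurable_fun setT (fun x => (rnorm (f x))%:E).
  exact/measurable_EFinP/measurable_rnorm.
move=> /(_ mf); apply: filterS => x /(_ I) [] fx _.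
exact: rnorm_eq0 fx.
Qed.

HB.instance Definition _ := Lmodule_isNormed.Build K L1
  L1_normD L1_normZ L1_norm_eq0.

Lemma rnorm_L1 (f : L1) : rnorm f = fine (\int[mu]_x (rnorm (f x))%:E)%E.
Proof. by rewrite -[RHS](re_of_real (k := k)). Qed.

(* The class of h if h is integrable, and 0 otherwise. *)
Definition L1_class (h : T -> K) : L1 := \pi_L1 (insubd 0 h).

Lemma L1_classP h : h \in integrable_scalar ->
  L1_repr (L1_class h) = h %[ae mu].
Proof.
move=> ih; apply: filterS (L1_reprP (insubd 0 h)) => x hx I0.
rewrite hx//; congr (_ x); exact: (insubdK (0 : L1fun) ih).
Qed.

End L1.

Section operators.
Context (R : realType) (k : scalar_kind).
Local Notation K := (scalar_field R k).

Definition unit_scalars : set K := [set w | `|w| = 1].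

(* [sup] is the real supremum, so [opnorm] is meaningful for bounded operators
   only; bounded linear operators are the continuous {linear X -> Y}. *)
Definition opnorm (X Y : normedModType K) (T : X -> Y) : R :=
  sup [set rnorm (T x) | x in [set x | rnorm x <= 1]].

Definition rank_one (X Y : normedModType K) (T : X -> Y) :=
  exists2 y : Y, y != 0 & range T = [set a *: y | a in [set: K]].

Definition alt_Daugavet_eq (X Y : normedModType K) (G T : X -> Y) :=
  sup [set opnorm (fun x => G x + w *: T x) | w in unit_scalars] = 1 + opnorm T.

Definition alt_Daugavet_property (X Y : normedModType K) (G : X -> Y) :=
  forall T : {linear X -> Y}, continuous T -> rank_one T ->
    alt_Daugavet_eq G T.

Definition spear_set (Y : normedModType K) (F : set Y) :=
  F `<=` [set z | rnorm z <= 1] /\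
  forall y : Y,
    sup [set rnorm (z + w *: y) | z in F & w in unit_scalars] = 1 + rnorm y.

End operators.

Section bochner.
Context (R : realType) (k : scalar_kind) d (T : measurableType d).
Variable mu : {measure set T -> \bar R}.
Variable Y : normedModType (scalar_field R k).

Definition vector_simple (s : T -> Y) :=
  finite_set (range s) /\ forall y, measurable (s @^-1` [set y]).

(* Only used for finite mu, for which [fine] loses nothing. *)
Definition simple_integral (s : T -> Y) : Y :=
  \sum_(y \in range s) of_real (fine (mu (s @^-1` [set y]))) *: y.

Definition strongly_measurable (g : T -> Y) :=
  exists2 s : nat -> T -> Y, forall n, vector_simple (s n) &
    \forall x \ae mu, s n x @[n --> \oo] --> g x.

Definition ess_bounded (g : T -> Y) :=
  (ess_sup mu (fun x => (rnorm (g x))%:E) < +oo)%E.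

(* y is the Bochner integral of h. If h is only almost everywhere a limit of
   simple functions then the integrand below is only almost everywhere equal to
   a measurable function; the integral of a nonnegative function being the
   supremum of the integrals of the simple functions below it, its value is
   that of the measurable function. *)
Definition is_bochner_integral (h : T -> Y) (y : Y) :=
  strongly_measurable h /\
  exists s : nat -> T -> Y,
    [/\ forall n, vector_simple (s n),
        (\int[mu]_x (rnorm (h x - s n x))%:E)%E @[n --> \oo] --> 0%E &
        simple_integral (s n) @[n --> \oo] --> y].

Definition representable (S : L1 k mu -> Y) :=
  exists g : T -> Y, [/\ strongly_measurable g, ess_bounded g &
    forall f : L1 k mu, is_bochner_integral (fun x => f x *: g x) (S f)].

End bochner.

Section averages.
Context (R : realType) (k : scalar_kind) d (T : measurableType d).
Variable mu : {measure set T -> \bar R}.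

Definition Gamma (A : set T) : set (L1 k mu) :=
  [set L1_class mu (fun x => of_real (k := k) (\1_B x / fine (mu B))) |
    B in [set B | [/\ measurable B, B `<=` A & (0 < mu B)%E]]].

End averages.

Arguments Gamma {R} k {d T} mu A.

(* Main.v *)
(* (i) => (ii): if the spear condition fails on A for some y != 0, apply (i) to
   the rank-one operator S f = (\int_A f) y. Then G + w S has norm at most
   c = max(1, 1 + |y| - e) on every normalized indicator: inside A by the failure
   of the spear condition, outside A because S vanishes there. Simple functions
   being dense, c bounds the norm of G + w S, which contradicts (i).
   (ii) => (iii): if S is represented by g, then g is within e of a constant v of
   norm almost |S| on some A of positive measure, so S is within e of v on Gamma_A,
   and the spear property of G(Gamma_A) is applied to v.
   (iii) => (i): S f = phi(f) y is representable, since B |-> phi(1_B) has a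
   bounded Radon-Nikodym density with respect to mu. *)
Require Import Defs.
From HB Require Import structures.
From mathcomp Require Import all_boot all_order all_algebra.
From mathcomp Require Import all_classical all_reals all_analysis.
From mathcomp Require Import measurable_realfun ess_sup_inf complex lra.
Import Order.TTheory GRing.Theory Num.Theory.
Import numFieldNormedType.Exports.
Set Implicit Arguments.
Unset Strict Implicit.
Unset Printing Implicit Defensive.
Local Open Scope classical_set_scope.
Local Open Scope ring_scope.

(** * Scalars and norms *)

(** The geometry of L1 enters through one fact, [bounded_op_indic]: the norm adds up over disjoint
    pieces, so a bound c m(B) on each indicator of B bounds a continuous operator by c everywhere.
    It produces the contradiction in (i) => (ii), and again in (ii) => (iii): if no suitable A and v
    existed, the representing function would be bounded by |S| - e almost everywhere, and so would
    S. The suprema need not be attained, so both the Daugavet equation and the spear condition are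
    handled as statements about approximation from below; the upper bounds are triangle
    inequalities. The obstacle is measurability: an almost everywhere limit of simple functions need
    not be measurable. Vector-valued estimates are therefore made on simple functions over a common
    finite partition, and the integrals of error terms are compared as suprema over simple
    functions. For the same reason the Radon-Nikodym density is rounded to simple functions with a
    uniform error, so that S can be compared with simple integrals fibre by fibre. *)

Lemma cvg_dist0 (R : realType) (u : nat -> R) (l : R) : u n @[n --> \oo] --> l ->
  `|l - u n| @[n --> \oo] --> 0.
Proof.
move=> /cvgrPdist_le ul; apply/cvgrPdist_le => e /ul; apply: filterS => n.
by rewrite sub0r normrN normr_id.
Qed.

Section norms.
Context (R : realType) (k : scalar_kind).
Local Notation K := (scalar_field R k).

Lemma rnormZ (V : normedModType K) (a : K) (v : V) :
  rnorm (a *: v) = rnorm a * rnorm v.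
Proof.
by apply: (@of_real_inj _ k); rewrite of_realM !of_real_rnorm normrZ.
Qed.

Lemma rnorm0 (V : normedZmodType K) : rnorm (0 : V) = 0.
Proof. by rewrite /rnorm normr0 re0. Qed.

Lemma rnormN (V : normedZmodType K) (v : V) : rnorm (- v) = rnorm v.
Proof. by rewrite /rnorm normrN. Qed.

Lemma rdistC (V : normedZmodType K) (v w : V) : rnorm (v - w) = rnorm (w - v).
Proof. by rewrite -rnormN opprB. Qed.

Lemma rdistD (V : normedZmodType K) (u v w : V) :
  rnorm (v - w) <= rnorm (v - u) + rnorm (u - w).
Proof. by rewrite -(subrKA u) rnormD. Qed.

Lemma rnorm_sum (V : normedZmodType K) (I : Type) (r : seq I) (F : I -> V) :
  rnorm (\sum_(i <- r) F i) <= \sum_(i <- r) rnorm (F i).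
Proof.
elim/big_ind2 : _ => [|v a w b va wb|//]; first by rewrite rnorm0.
exact: le_trans (rnormD _ _) (lerD va wb).
Qed.

Lemma rnorm_of_real (a : R) : rnorm (of_real a : K) = `|a|.
Proof. by rewrite rnormE re_of_real im_of_real expr0n addr0 sqrtr_sqr. Qed.

Lemma rnorm1 : rnorm (1 : K) = 1.
Proof.
apply: (@of_real_inj _ k); rewrite of_real_rnorm normr1.
by rewrite /of_real; case: k => //=; rewrite rmorph1.
Qed.

Lemma of_real1 : of_real 1 = 1 :> K.
Proof. by rewrite -[in LHS]rnorm1 of_real_rnorm normr1. Qed.

Lemma of_real_sum (I : Type) (r : seq I) (F : I -> R) :
  of_real (\sum_(i <- r) F i) = \sum_(i <- r) of_real (F i) :> K.
Proof.
elim/big_ind2 : _ => [|u a v b <- <-|]//; first exact: of_real0.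
exact: of_realD.
Qed.

Lemma of_realN (a : R) : of_real (- a) = - of_real a :> K.
Proof. by apply: (addrI (of_real a)); rewrite -of_realD !subrr of_real0. Qed.

Lemma rnorm_unit (w : K) : unit_scalars w -> rnorm w = 1.
Proof. by rewrite /rnorm => ->; rewrite -[RHS]rnorm1 /rnorm normr1. Qed.

Lemma unit_scalars1 : unit_scalars (1 : K).
Proof. exact: normr1. Qed.

Lemma rnormZ_unit (V : normedModType K) (w : K) (v : V) :
  unit_scalars w -> rnorm (w *: v) = rnorm v.
Proof. by move=> /rnorm_unit w1; rewrite rnormZ w1 mul1r. Qed.

Lemma scalar_gt0P (e : K) : 0 < e -> exists2 a : R, 0 < a & e = of_real a.
Proof.
move=> e0; exists (rnorm e); last by rewrite of_real_rnorm gtr0_norm.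
rewrite lt_def rnorm_ge0 andbT; apply: contraTneq e0 => /rnorm_eq0 ->.
by rewrite ltxx.
Qed.

Lemma rnorm_cvgP (V : normedModType K) (T : Type) (F : set_system T)
    (FF : Filter F) (u : T -> V) (l : V) :
  u x @[x --> F] --> l <->
  forall e : R, 0 < e -> \forall x \near F, rnorm (l - u x) <= e.
Proof.
split=> [/cvgrPdist_le ul e e0|ul].
  have /ul : (0 : K) < of_real e.
    by rewrite lt_def -{1}of_real0 (inj_eq (@of_real_inj _ _)) gt_eqF//=
      -of_real0 ler_of_real ltW.
  by apply: filterS => x; rewrite -of_real_rnorm ler_of_real.
apply/cvgrPdist_le => e /scalar_gt0P[a /ul ula ->].
by apply: filterS ula => x; rewrite -of_real_rnorm ler_of_real.
Qed.

Lemma rnorm_cvg0_le (V : normedModType K) (u : nat -> V) (l : V) (r : nat -> R) :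
  (forall n, rnorm (l - u n) <= r n) -> r n @[n --> \oo] --> 0 ->
  u n @[n --> \oo] --> l.
Proof.
move=> ur /cvgrPdist_le r0; apply/rnorm_cvgP => e /r0.
apply: filterS => n; rewrite sub0r normrN => rn.
exact: le_trans (ur n) (le_trans (ler_norm _) rn).
Qed.

(* The imaginary unit, with the junk value 0 over the reals. *)
Definition imag_unit : K :=
  match k return scalar_field R k with
  | RealScalars => 0
  | ComplexScalars => complex.Complex 0 1
  end.

Lemma scalarE (z : K) : z = of_real (re z) + imag_unit * of_real (im z).
Proof.
rewrite /imag_unit /of_real /re /im; case: k z => [z|[a b]] /=.
  by rewrite mul0r addr0.
exact: complexE.
Qed.

Lemma scalar_ext (z w : K) :
  re z = re w -> im z = im w -> z = w.
Proof. by move=> rzw izw; rewrite (scalarE z) (scalarE w) rzw izw. Qed.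

Lemma re_imag_unitM (a : R) : re (imag_unit * of_real a) = 0.
Proof.
rewrite reM re_of_real im_of_real mulr0 subr0.
by rewrite /re /imag_unit; case: k => /=; rewrite mul0r.
Qed.

Lemma rnorm_imag_unit : rnorm imag_unit <= 1.
Proof.
rewrite rnormE /re /im /imag_unit; case: k => /=.
  by rewrite expr0n addr0 sqrtr0.
by rewrite expr0n add0r expr1n sqrtr1.
Qed.

Lemma ler_re_rnorm (z : K) : `|re z| <= rnorm z.
Proof.
rewrite rnormE -sqrtr_sqr; apply: ler_wsqrtr.
by rewrite lerDl sqr_ge0.
Qed.

Lemma ler_im_rnorm (z : K) : `|im z| <= rnorm z.
Proof.
rewrite rnormE -[leLHS]sqrtr_sqr; apply: ler_wsqrtr.
by rewrite lerDr sqr_ge0.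
Qed.

Lemma rdist_scalar (z : K) (a b : R) :
  rnorm (z - (of_real a + imag_unit * of_real b)) <= `|re z - a| + `|im z - b|.
Proof.
rewrite [z in leLHS]scalarE opprD addrACA -mulrBr -!of_realN -!of_realD.
apply: le_trans (rnormD _ _) _; rewrite rnorm_of_real lerD2l.
by rewrite rnormM rnorm_of_real ler_piMl// rnorm_imag_unit.
Qed.

End norms.

(** * Operators and the alternative Daugavet equation *)

(** The real [sup] has a default value, hence the two hypotheses. In the uses below the upper bound
    is a triangle inequality, and only approximation from below carries content. *)
Lemma sup_eqP (R : realType) (E : set R) (s : R) : E !=set0 -> ubound E s ->
  sup E = s <-> forall e, 0 < e -> exists2 x, E x & s - e < x.
Proof.
move=> E0 Es; have supE : has_sup E by split=> //; exists s.
split=> [<- e e0|Ee]; first by have [x] := sup_adherent e0 supE; exists x.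
apply/eqP; rewrite eq_le ge_sup//= leNgt; apply/negP => lts.
have [|x Ex] := Ee (s - sup E); first by rewrite subr_gt0.
by rewrite subKr ltNge ub_le_sup//; case: supE.
Qed.

Lemma linear_map_of (K : pzRingType) (X Y : lmodType K) (f : X -> Y) :
  linear f -> exists S : {linear X -> Y}, forall x, S x = f x.
Proof.
move=> lf; pose S : {linear X -> Y} := HB.pack f (GRing.isLinear.Build K X Y _ _ lf).
by exists S.
Qed.

Section operators.
Context (R : realType) (k : scalar_kind).
Local Notation K := (scalar_field R k).

Definition bounded_op (X Y : normedModType K) (P : X -> Y) (M : R) :=
  forall x, rnorm (P x) <= M * rnorm x.

Lemma continuous_bounded_op (X Y : normedModType K) (P : {linear X -> Y}) :
  continuous P -> exists2 M, 0 <= M & bounded_op P M.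
Proof.
move=> /linear_bounded_continuous/linear_boundedP [r [rr rP]].
exists (rnorm r + 1); first by rewrite addr_ge0 ?rnorm_ge0.
move=> x; rewrite -(ler_of_real (k := k)) of_realM !of_real_rnorm; apply: rP.
rewrite of_realD of_real_rnorm of_real1.
by apply: le_lt_trans (real_ler_norm rr) _; rewrite ltrDl ltr01.
Qed.

Lemma bounded_op_continuous (X Y : normedModType K) (P : {linear X -> Y}) M :
  bounded_op P M -> continuous P.
Proof.
move=> PM; apply/linear_bounded_continuous/linear_boundedP.
(* [linear_boundedP] asks for a bound that is real inside the scalar field, which a norm always
   is. *)
exists `|of_real M : K|; split => [|r Mr x]; first exact: normr_real.
rewrite -[`|P x|]of_real_rnorm -[`|x|]of_real_rnorm.
apply: (@le_trans _ _ (of_real (M * rnorm x))); first by rewrite ler_of_real.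
rewrite of_realM ler_wpM2r ?of_real_rnorm//.
apply: le_trans (ltW Mr); rewrite -of_real_rnorm rnorm_of_real ler_of_real.
exact: ler_norm.
Qed.

Section bounded.
Context (X Y : normedModType K) (P : X -> Y) (M : R).
Hypothesis PM : bounded_op P M.
Hypothesis M0 : 0 <= M.

Let E := [set rnorm (P x) | x in [set x | rnorm x <= 1]].

Let E_ub : ubound E M.
Proof.
by move=> _ [x x1 <-]; apply: le_trans (PM x) _; rewrite ler_piMr.
Qed.

Let E_sup : has_sup E.
Proof.
by split; [exists (rnorm (P 0)), 0 => //=; rewrite rnorm0|exists M].
Qed.

Lemma opnorm_le : opnorm P <= M.
Proof. by apply: ge_sup E_ub; case: E_sup. Qed.

Lemma opnorm_ub x : rnorm x <= 1 -> rnorm (P x) <= opnorm P.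
Proof. by move=> x1; apply: ub_le_sup; [case: E_sup|exists x]. Qed.

Lemma opnorm_ge0 : 0 <= opnorm P.
Proof. by apply: le_trans (rnorm_ge0 _) (@opnorm_ub 0 _); rewrite rnorm0. Qed.

Lemma opnorm_adherent e : 0 < e ->
  exists2 x, rnorm x <= 1 & opnorm P - e < rnorm (P x).
Proof. by move=> e0; have [_ [x x1 <-]] := sup_adherent e0 E_sup; exists x. Qed.

End bounded.

Lemma bounded_op_opnorm (X Y : normedModType K) (P : X -> Y) M :
  (forall a x, P (a *: x) = a *: P x) -> 0 <= M -> bounded_op P M ->
  bounded_op P (opnorm P).
Proof.
move=> PZ M0 PM x; have [x0|xN0] := eqVneq (rnorm x) 0.
  by rewrite (rnorm_eq0 x0) -(scale0r 0) PZ !scale0r !rnorm0 mulr0.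
have x0 : 0 < rnorm x by rewrite lt_def xN0 rnorm_ge0.
rewrite -ler_pdivrMr//; have xV0 : 0 <= (rnorm x)^-1 by rewrite invr_ge0 ltW.
have -> : rnorm (P x) / rnorm x = rnorm (P (of_real (rnorm x)^-1 *: x)).
  by rewrite PZ rnormZ rnorm_of_real ger0_norm// mulrC.
apply: opnorm_ub PM M0 _ _.
by rewrite rnormZ rnorm_of_real ger0_norm// mulVf.
Qed.

Lemma opnormD (X Y : normedModType K) (G T : {linear X -> Y}) (w : K) :
  continuous G -> continuous T -> unit_scalars w ->
  bounded_op (fun x => G x + w *: T x) (opnorm G + opnorm T).
Proof.
move=> /continuous_bounded_op[M M0 GM] /continuous_bounded_op[N N0 TN] w1 x.
apply: le_trans (rnormD _ _) _; rewrite rnormZ_unit// mulrDl lerD//.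
  by apply: (bounded_op_opnorm _ M0 GM) => a y; rewrite linearZ.
by apply: (bounded_op_opnorm _ N0 TN) => a y; rewrite linearZ.
Qed.

Lemma opnorm_linear_ge0 (X Y : normedModType K) (G : {linear X -> Y}) :
  continuous G -> 0 <= opnorm G.
Proof. by move=> /continuous_bounded_op[M M0 GM]; exact: opnorm_ge0 GM M0. Qed.

(** As [opnorm G = 1], the upper bound 1 + |T| is automatic, and the nested suprema over scalars and
    over the ball merge into one choice of w and x. *)
Lemma alt_Daugavet_eqP (X Y : normedModType K) (G T : {linear X -> Y}) :
  continuous G -> continuous T -> opnorm G = 1 ->
  alt_Daugavet_eq G T <-> forall e, 0 < e -> exists w x,
    [/\ unit_scalars w, rnorm x <= 1 &
        1 + opnorm T - e < rnorm (G x + w *: T x)].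
Proof.
move=> cG cT G1; rewrite /alt_Daugavet_eq.
have T0 := opnorm_linear_ge0 cT.
have GT0 : 0 <= 1 + opnorm T by rewrite addr_ge0.
have GT w : unit_scalars w ->
    bounded_op (fun x => G x + w *: T x) (1 + opnorm T).
  by rewrite -G1; exact: opnormD.
split=> [/sup_eqP GTe e e0|GTe].
  (* One half is lost in the supremum over w, the other in the operator norm. *)
  have e20 : 0 < e / 2 by rewrite divr_gt0.
  have [] := GTe _ _ (e / 2) => //.
  - by eexists; exists 1 => //; exact: unit_scalars1.
  - by move=> _ [w /GT Gw <-]; exact: opnorm_le.
  move=> _ [w w1 <-] we.
  have [x x1 xe] := opnorm_adherent (GT w w1) GT0 e20.
  exists w, x; split => //; apply: le_lt_trans xe.
  by move: we; set t := opnorm (fun=> _); lra.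
apply/sup_eqP => [||e /GTe[w [x [w1 x1 xe]]]].
- by eexists; exists 1 => //; exact: unit_scalars1.
- by move=> _ [w /GT Gw <-]; exact: opnorm_le.
- by eexists; [exists w|apply: lt_le_trans xe (opnorm_ub (GT w w1) GT0 x1)].
Qed.

Lemma spear_setP (Y : normedModType K) (F : set Y) : F !=set0 ->
  F `<=` [set z | rnorm z <= 1] ->
  spear_set F <-> forall y e, 0 < e -> exists w z,
    [/\ unit_scalars w, F z & 1 + rnorm y - e < rnorm (z + w *: y)].
Proof.
move=> [z0 Fz0] F1.
have ub y : ubound [set rnorm (z + w *: y) | z in F & w in @unit_scalars R k]
    (1 + rnorm y).
  move=> _ [z Fz [w w1 <-]]; apply: le_trans (rnormD _ _) _.
  by rewrite rnormZ_unit// lerD2r F1.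
have ne y : [set rnorm (z + w *: y) | z in F & w in @unit_scalars R k] !=set0.
  by exists (rnorm (z0 + 1 *: y)), z0 => //; exists 1 => //; exact: unit_scalars1.
split=> [[_ Fs] y e e0|Fs].
  have [_ [z Fz [w w1 <-]] ze] := (sup_eqP (ne y) (ub y)).1 (Fs y) e e0.
  by exists w, z.
split=> // y; apply/(sup_eqP (ne y) (ub y)) => e e0.
have [w [z [w1 Fz ze]]] := Fs y e e0.
by exists (rnorm (z + w *: y)) => //; exists z => //; exists w.
Qed.

End operators.

(** * Simple maps *)

Section simple_maps.
Context d (T : measurableType d).

(** Values lie in an arbitrary [choiceType], so that simple functions with different codomains can
    be paired and studied on a common partition. The list may contain values that are not attained;
    their fibres are empty. *)
Definition simple_map (Z : choiceType) (q : T -> Z) (r : seq Z) :=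
  [/\ uniq r, forall x, q x \in r & forall z, measurable (q @^-1` [set z])].

Lemma simple_map_preimage (Z : choiceType) (q : T -> Z) r (A : set Z) :
  simple_map q r -> measurable (q @^-1` A).
Proof.
move=> [_ qr mq].
rewrite (_ : _ @^-1` _ = \bigcup_(z in [set` r] `&` A) (q @^-1` [set z])).
  by apply: fin_bigcup_measurable => //; exact/finite_setIl/finite_seq.
apply/seteqP; split => [x Ax|x [z [_ Az] /= ->]//].
by exists (q x) => //; split => //; exact: qr.
Qed.

Lemma simple_map_comp (Z Z' : choiceType) (q : T -> Z) r (f : Z -> Z') :
  simple_map q r -> simple_map (f \o q) (undup (map f r)).
Proof.
move=> qr; have [_ qr' _] := qr; split; first exact: undup_uniq.
  by move=> x; rewrite /= mem_undup map_f.
by move=> z; exact: (simple_map_preimage (f @^-1` [set z]) qr).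
Qed.

Lemma simple_map_pair (Z Z' : choiceType) (q : T -> Z) (q' : T -> Z') r r' :
  simple_map q r -> simple_map q' r' ->
  simple_map (fun x => (q x, q' x)) (allpairs pair r r').
Proof.
move=> [ur qr mq] [ur' qr' mq']; split.
- by apply: allpairs_uniq => // -[a b] [c e] _ _ [-> ->].
- by move=> x; apply: allpairs_f.
- move=> [a b]; rewrite (_ : _ @^-1` _ = q @^-1` [set a] `&` q' @^-1` [set b]).
    exact: measurableI.
  by apply/seteqP; split => [x [<- <-]//|x [/= <- <-]].
Qed.

Lemma simple_map_mem (B : set T) : measurable B ->
  simple_map (fun x => x \in B) [:: true; false].
Proof.
move=> mB; split=> //; first by move=> x; case: (x \in B).
case.
  rewrite (_ : _ @^-1` _ = B)//; apply/seteqP.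
  by split=> x; rewrite /= -[B x]inE => ->.
rewrite (_ : _ @^-1` _ = ~` B); first exact: measurableC.
apply/seteqP; split=> x; rewrite /= -[B x]inE; first by move=> ->.
by move/negP/negbTE.
Qed.

Lemma simple_map_additive (V : zmodType) (nu : set T -> V) (Z : choiceType)
    (q : T -> Z) r (A : set T) :
  nu set0 = 0 -> (forall B C, measurable B -> measurable C ->
    B `&` C = set0 -> nu (B `|` C) = nu B + nu C) ->
  simple_map q r -> measurable A ->
  nu A = \sum_(z <- r) nu (A `&` q @^-1` [set z]).
Proof.
move=> nu0 nuD qr mA; have [ur qr' mq] := qr.
(* The induction runs over lists whose fibres need not cover A. *)
suff H s : uniq s -> nu (A `&` q @^-1` [set` s]) =
    \sum_(z <- s) nu (A `&` q @^-1` [set z]).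
  rewrite -H//; congr nu; apply/seteqP; split => [x Ax|x []//].
  by split => //; exact: qr'.
elim: s => [_|z s IHs /= /andP[zs us]].
  rewrite big_nil (_ : _ `&` _ = set0)//.
  by apply/seteqP; split => [x [_ /=]|x []//]; rewrite in_nil.
rewrite big_cons -IHs// -nuD//.
- congr nu; rewrite -setIUr; congr (_ `&` _); apply/seteqP; split => x /=.
    by rewrite inE => /orP[/eqP->|]; [left|right].
  by rewrite inE => -[->|->]; rewrite ?eqxx ?orbT.
- exact: measurableI.
- by apply: measurableI => //; exact: simple_map_preimage qr.
- apply/seteqP; split => [x [[_ /= ->] [_ /=]]|x []//].
  by rewrite (negbTE zs).
Qed.

End simple_maps.

(** * Integrals of simple functions for a probability measure *)

Section vector_simple.
Context (R : realType) (k : scalar_kind) d (T : measurableType d).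
Variables (mu : probability T R) (Y : normedModType (scalar_field R k)).

Definition pmass (A : set T) : R := fine (mu A).

Lemma pmassE A : measurable A -> (pmass A)%:E = mu A.
Proof. by move=> mA; rewrite fineK// fin_num_measure. Qed.

Lemma pmass_ge0 A : 0 <= pmass A.
Proof. exact/fine_ge0/measure_ge0. Qed.

Lemma pmass0 : pmass set0 = 0.
Proof. by rewrite /pmass measure0. Qed.

Lemma pmassU A B : measurable A -> measurable B -> A `&` B = set0 ->
  pmass (A `|` B) = pmass A + pmass B.
Proof.
move=> mA mB AB; apply: EFin_inj; rewrite EFinD !pmassE//; last exact: measurableU.
by rewrite measureU.
Qed.

Lemma pmass_gt0 A : measurable A -> (0 < mu A)%E = (0 < pmass A).
Proof. by move=> mA; rewrite -pmassE. Qed.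

Lemma vector_simpleP (s : T -> Y) :
  vector_simple s <-> exists r, simple_map s r.
Proof.
split=> [[fs ms]|[r [ur sr ms]]].
  exists (finmap.enum_fset (fset_set (range s))); split => //.
  by move=> x; rewrite (in_fset_set fs) inE; exists x.
split=> //; apply: (@sub_finite_set _ _ [set` r]); last exact: finite_seq.
by move=> _ [x _ <-]; exact: sr.
Qed.

Lemma simple_integralE (s : T -> Y) r : simple_map s r ->
  simple_integral mu s = \sum_(y <- r) of_real (pmass (s @^-1` [set y])) *: y.
Proof.
move=> [ur sr ms]; rewrite /simple_integral (fsbig_fwiden r)//.
  by move=> _ [x _ <-]; exact: sr.
move=> y [_ ys]; rewrite /= (_ : _ @^-1` _ = set0) ?measure0 ?of_real0 ?scale0r//.
by apply/seteqP; split => // x /= sx; apply: ys; exists x.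
Qed.

(** [f] may merge fibres of [q]: each level set of [f \o q] is cut along [q] and the double sum is
    exchanged. Simple integrals can thus be computed on any finer partition, and in particular
    subtracted on a common one. *)
Lemma simple_integral_comp (Z : choiceType) (q : T -> Z) r (f : Z -> Y) :
  simple_map q r -> simple_integral mu (f \o q) =
  \sum_(z <- r) of_real (pmass (q @^-1` [set z])) *: f z.
Proof.
move=> qr; rewrite (simple_integralE (simple_map_comp f qr)).
have [ur _ mq] := qr.
under eq_bigr => y _.
  rewrite (simple_map_additive pmass0 pmassU qr); last first.
    exact: (simple_map_preimage (f @^-1` [set y]) qr).
  rewrite of_real_sum scaler_suml; over.
rewrite exchange_big; apply: eq_big_seq => z zr /=.
rewrite (bigD1_seq (f z)) ?undup_uniq ?mem_undup ?map_f//=.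
rewrite big1 ?addr0 => [|y yz].
  congr (of_real (pmass _) *: _).
  by apply/seteqP; split => [x []//|x /= ->].
rewrite (_ : _ `&` _ = set0) ?pmass0 ?of_real0 ?scale0r//.
apply/seteqP; split => // x [/= fq qz]; move: yz.
by rewrite -fq qz eqxx.
Qed.

Lemma simple_map_integral (Z : choiceType) (q : T -> Z) r (f : Z -> R) :
  simple_map q r -> (forall z, 0 <= f z) ->
  (\int[mu]_x (f (q x))%:E)%E = (\sum_(z <- r) pmass (q @^-1` [set z]) * f z)%:E.
Proof.
move=> qr f0; have [ur qr' mq] := qr.
have fE x : ((f (q x))%:E = \sum_(z <- r) (f z)%:E * (\1_(q @^-1` [set z]) x)%:E)%E.
  rewrite (bigD1_seq (q x))//= indicE mem_set// mule1 big1 ?adde0// => z zq.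
  by rewrite indicE memNset ?mule0// => /= qz; move: zq; rewrite qz eqxx.
under eq_integral do rewrite fE.
rewrite ge0_integral_sum//; last 2 first.
- by move=> z; apply: measurable_funeM; exact/measurable_EFinP/measurable_indic.
- by move=> z x _; rewrite mule_ge0// lee_fin.
rewrite -sumEFin; apply: eq_bigr => z _.
rewrite ge0_integralZl ?lee_fin//; last first.
  exact/measurable_EFinP/measurable_indic.
by rewrite integral_indic// setIT EFinM pmassE// muleC.
Qed.

End vector_simple.

(** * Indicators and simple functions in L1 *)

Section L1_theory.
Context (R : realType) (k : scalar_kind) d (T : measurableType d).
Variable mu : probability T R.
Local Notation K := (scalar_field R k).
Local Notation L1 := (L1 k mu).
Local Notation m := (pmass mu).
Local Open Scope quotient_scope.

Lemma L1_ext (f g : L1) : (f : T -> K) = g %[ae mu] -> f = g.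
Proof. by move=> fg; rewrite -[f]reprK -[g]reprK; apply/L1_piP. Qed.

Lemma L1_repr_integrable (f : L1) : (f : T -> K) \in integrable_scalar mu.
Proof. exact: valP (repr f). Qed.

Lemma L1_reprD (f g : L1) :
  ((f + g : L1) : T -> K) = (fun x => f x + g x) %[ae mu].
Proof. exact: (L1_reprP (repr f + repr g)). Qed.

Lemma L1_reprZ (a : K) (f : L1) :
  ((a *: f : L1) : T -> K) = (fun x => a * f x) %[ae mu].
Proof. exact: (L1_reprP (a *: repr f)). Qed.

Lemma L1_reprB (f g : L1) :
  ((f - g : L1) : T -> K) = (fun x => f x - g x) %[ae mu].
Proof.
rewrite -scaleN1r; apply: filterS2 (L1_reprD f (-1 *: g)) (L1_reprZ (-1) g).
by move=> x -> // gx _; rewrite gx// mulN1r.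
Qed.

Lemma L1_class_eq (f : L1) (h : T -> K) : h \in integrable_scalar mu ->
  (f : T -> K) = h %[ae mu] -> f = L1_class mu h.
Proof.
move=> ih fh; apply: L1_ext; apply: filterS2 fh (L1_classP ih).
by move=> x fh hh _; rewrite fh// hh.
Qed.

Lemma L1_classD (g h : T -> K) :
  g \in integrable_scalar mu -> h \in integrable_scalar mu ->
  L1_class mu (fun x => g x + h x) = L1_class mu g + L1_class mu h.
Proof.
move=> ig ih; apply/esym/L1_class_eq; first exact: (rpredD ig ih).
apply: filterS3 (L1_classP ig) (L1_classP ih)
  (L1_reprD (L1_class mu g) (L1_class mu h)) => x gx hx -> //.
by rewrite gx// hx.
Qed.

Lemma L1_classZ (a : K) (h : T -> K) : h \in integrable_scalar mu ->
  L1_class mu (fun x => a * h x) = a *: L1_class mu h.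
Proof.
move=> ih; apply/esym/L1_class_eq; first exact: (rpredZ a ih).
apply: filterS2 (L1_reprZ a (L1_class mu h)) (L1_classP ih) => x -> // hx _.
by rewrite hx.
Qed.

Lemma rnorm_L1_ae (f : L1) (h : T -> K) : h \in integrable_scalar mu ->
  (f : T -> K) = h %[ae mu] -> (rnorm f)%:E = (\int[mu]_x (rnorm (h x))%:E)%E.
Proof.
move=> ih fh; have -> : f = \pi_L1 (MkL1fun ih).
  apply: L1_ext; apply: filterS2 fh (L1_reprP (MkL1fun ih)).
  by move=> x fh hh _; rewrite fh// hh.
by rewrite -(L1_norm_pi (MkL1fun ih)) rnorm_L1.
Qed.

Lemma simple_map_measurable (Z : choiceType) (q : T -> Z) r d'
    (T' : sigmaRingType d') (f : Z -> T') :
  simple_map q r -> measurable_fun setT (f \o q).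
Proof.
move=> qr _ A mA; rewrite setTI.
exact: (simple_map_preimage (f @^-1` A) qr).
Qed.

Lemma simple_map_Lfun (Z : choiceType) (q : T -> Z) r (f : Z -> R) :
  simple_map q r -> f \o q \in Lfun mu 1.
Proof.
move=> qr; apply/Lfun1_integrable/integrableP; split.
  by apply/measurable_EFinP; exact: simple_map_measurable qr.
rewrite [ltLHS](_ : _ = \int[mu]_x (`|f (q x)|%R)%:E)%E//.
by rewrite (simple_map_integral mu (f := fun z => `|f z|) qr) ?ltry.
Qed.

Lemma simple_map_integrable (Z : choiceType) (q : T -> Z) r (f : Z -> K) :
  simple_map q r -> f \o q \in integrable_scalar mu.
Proof.
move=> qr; apply/andP; split.
  exact: (simple_map_Lfun (re \o f) qr).
exact: (simple_map_Lfun (im \o f) qr).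
Qed.

Definition L1_indic (B : set T) : L1 := L1_class mu (fun x => of_real (\1_B x)).

Lemma indic_integrable (B : set T) : measurable B ->
  (fun x => of_real (\1_B x) : K) \in integrable_scalar mu.
Proof.
move=> /simple_map_mem /(simple_map_integrable (fun b : bool => of_real b%:R : K)).
by congr (_ \in _); apply/funext => x; rewrite /= indicE.
Qed.

Lemma L1_indic0 : L1_indic set0 = 0.
Proof.
rewrite -[RHS](scale0r (L1_indic set0)) -L1_classZ ?indic_integrable//.
by congr L1_class; apply/funext => x; rewrite mul0r indic0 of_real0.
Qed.

Lemma L1_indicU (A B : set T) : measurable A -> measurable B ->
  A `&` B = set0 -> L1_indic (A `|` B) = L1_indic A + L1_indic B.
Proof.
move=> mA mB AB; rewrite -L1_classD ?indic_integrable//.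
congr L1_class; apply/funext => x.
rewrite -of_realD !indicE in_setU; congr of_real.
case: (boolP (x \in A)) (boolP (x \in B)) => [Ax|_] [Bx|_];
  rewrite ?addr0 ?add0r//.
by have : x \in A `&` B; [rewrite in_setI Ax|rewrite AB in_set0].
Qed.

Lemma L1_class_simple (Z : choiceType) (q : T -> Z) r (f : Z -> K) :
  simple_map q r ->
  L1_class mu (f \o q) = \sum_(z <- r) f z *: L1_indic (q @^-1` [set z]).
Proof.
move=> qr; have [ur qr' mq] := qr.
have qE x : (f \o q) x = \sum_(z <- r) f z * of_real (\1_(q @^-1` [set z]) x).
  rewrite (bigD1_seq (q x))//= indicE mem_set// of_real1 mulr1 big1 ?addr0//.
  move=> z zq; rewrite indicE memNset ?of_real0 ?mulr0// => /= qz.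
  by move: zq; rewrite qz eqxx.
rewrite (funext qE).
have iz z : (fun x => f z * of_real (\1_(q @^-1` [set z]) x)) \in
  integrable_scalar mu by exact: (rpredZ (f z) (indic_integrable (mq z))).
(* [L1_class] is 0 on non-integrable functions, so the induction has to carry integrability of the
   partial sums. *)
suff [] : ((fun x => \sum_(z <- r) f z * of_real (\1_(q @^-1` [set z]) x)) \in
    integrable_scalar mu) /\
  L1_class mu (fun x => \sum_(z <- r) f z * of_real (\1_(q @^-1` [set z]) x)) =
    \sum_(z <- r) f z *: L1_indic (q @^-1` [set z]) by [].
elim: (r) => [|z s [ihs IHs]].
  under eq_fun do rewrite big_nil; rewrite big_nil; split.
    exact: (rpred0 (@integrable_scalar R k d T mu)).
  by rewrite -L1_indic0; congr L1_class; apply/funext => x; rewrite indic0 of_real0.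
under eq_fun do rewrite big_cons; split; first exact: (rpredD (iz z) ihs).
by rewrite big_cons L1_classD// IHs L1_classZ// indic_integrable.
Qed.

Lemma rnorm_L1_simple (Z : choiceType) (q : T -> Z) r (f : Z -> K) :
  simple_map q r -> rnorm (L1_class mu (f \o q)) =
  \sum_(z <- r) m (q @^-1` [set z]) * rnorm (f z).
Proof.
move=> qr; have iq := simple_map_integrable f qr; apply: EFin_inj.
rewrite (rnorm_L1_ae iq (L1_classP iq)).
exact: (simple_map_integral mu qr (fun z => rnorm_ge0 (f z))).
Qed.

Lemma rnorm_L1_indic B : measurable B -> rnorm (L1_indic B) = m B.
Proof.
move=> mB; have iB := indic_integrable mB; apply: EFin_inj.
rewrite (rnorm_L1_ae iB (L1_classP iB)) pmassE//.
under eq_integral do rewrite rnorm_of_real ger0_norm//.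
by rewrite integral_indic// setIT.
Qed.

Lemma Gamma_elt B : measurable B ->
  L1_class mu (fun x => of_real (\1_B x / fine (mu B))) =
  of_real (m B)^-1 *: L1_indic B.
Proof.
move=> mB; rewrite -L1_classZ ?indic_integrable//; congr L1_class.
by apply/funext => x; rewrite mulrC of_realM.
Qed.

End L1_theory.

Import HBSimple.

(** * Density of simple functions, and operator bounds tested on indicators *)

Section L1_density.
Context (R : realType) (k : scalar_kind) d (T : measurableType d).
Variable mu : probability T R.
Local Notation K := (scalar_field R k).
Local Notation L1 := (L1 k mu).
Local Notation m := (pmass mu).

Lemma simple_map_sfun (g : {sfun T >-> R}) : exists r, simple_map (g : T -> R) r.
Proof.
exists (finmap.enum_fset (fset_set (range g))); split=> //.
by move=> x; rewrite (in_fset_set (fimfunP g)) inE; exists x.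
Qed.

(** Real and imaginary parts are approximated separately. Convergence in norm serves the operator
    estimates; convergence at every point serves strong measurability of the products
    [f x *: g x]. *)
Lemma L1_simple_approx (f : L1) : exists q : nat -> T -> K,
  [/\ forall n, exists r, simple_map (q n) r,
      forall x, q n x @[n --> \oo] --> f x &
      rnorm (f - L1_class mu (q n)) @[n --> \oo] --> 0].
Proof.
have /andP[/= /Lfun1_integrable rf /Lfun1_integrable imf] := L1_repr_integrable f.
have [g [ig gf gL]] := approximation_sfun_integrable measurableT rf.
have [h [ih hf hL]] := approximation_sfun_integrable measurableT imf.
pose c (ab : R * R) : K := of_real ab.1 + imag_unit R k * of_real ab.2.
pose q n x := c (g n x, h n x).
have qs n : exists r, simple_map (q n) r.
  have [r gr] := simple_map_sfun (g n); have [s hs] := simple_map_sfun (h n).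
  by eexists; exact: (simple_map_comp c (simple_map_pair gr hs)).
have q_int n : q n \in integrable_scalar mu.
  by have [r qr] := qs n; exact: simple_map_integrable (id : K -> K) qr.
exists q; split => // [x|].
  pose e n := `|re (f x) - g n x| + `|im (f x) - h n x|.
  apply: (@rnorm_cvg0_le _ _ _ _ _ e) => [n|]; first exact: rdist_scalar.
  rewrite -(addr0 0); apply: cvgD; apply: cvg_dist0.
    exact: (fine_cvg (gf x I)).
  exact: (fine_cvg (hf x I)).
apply: (@fine_cvg _ _ _ _ (fun n => (rnorm (f - L1_class mu (q n)))%:E)).
have qf n : ((f - L1_class mu (q n) : L1) : T -> K) = (fun x => f x - q n x) %[ae mu].
  apply: filterS2 (L1_reprB f (L1_class mu (q n))) (L1_classP (q_int n)).
  by move=> x -> // qx _; rewrite qx.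
have fq_int n : (fun x => f x - q n x) \in integrable_scalar mu.
  exact: (rpredB (L1_repr_integrable f) (q_int n)).
have cvg0 := cvgeD (isT : (0 +? 0)%E) gL hL _; rewrite adde0 in cvg0.
apply: (squeeze_cvge _ (cvg_cst 0%E) (cvg0 _)); apply: nearW => n.
have mg : measurable_fun setT (fun x => `|(re (f x))%:E - (g n x)%:E|%E).
  by apply/measurableT_comp => //; apply: emeasurable_funB;
    [exact: measurable_int rf|exact/measurable_EFinP].
have mh : measurable_fun setT (fun x => `|(im (f x))%:E - (h n x)%:E|%E).
  by apply/measurableT_comp => //; apply: emeasurable_funB;
    [exact: measurable_int imf|exact/measurable_EFinP].
rewrite lee_fin rnorm_ge0/= (rnorm_L1_ae (fq_int n) (qf n)) -ge0_integralD//.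
apply: ge0_le_integral => //.
- by move=> x _; rewrite lee_fin rnorm_ge0.
- exact/measurable_EFinP/(measurable_rnorm (MkL1fun (fq_int n))).
- exact: emeasurable_funD.
- by move=> x _; rewrite -EFinD lee_fin; exact: rdist_scalar.
Qed.

(** On a simple function the L1 norm is the sum of the norms of its pieces, so the triangle
    inequality transports the bound from indicators without loss; density does the rest. The bound M
    given by continuity multiplies only the approximation error and disappears in the limit. *)
Lemma bounded_op_indic (Y : normedModType K) (P : {linear L1 -> Y}) (c : R) :
  continuous P -> 0 <= c ->
  (forall B, measurable B -> rnorm (P (L1_indic k mu B)) <= c * m B) ->
  bounded_op P c.
Proof.
move=> /continuous_bounded_op[M M0 PM] c0 Pc f.
have [q [qs _ qf]] := L1_simple_approx f.
have le_n n : rnorm (P f) <=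
    c * rnorm f + (M + c) * rnorm (f - L1_class mu (q n)).
  have [r qr] := qs n; set F := L1_class mu (q n).
  have PF : rnorm (P F) <= c * rnorm F.
    rewrite /F (L1_class_simple mu (id : K -> K) qr) raddf_sum/=.
    rewrite -(L1_class_simple mu (id : K -> K) qr).
    rewrite (rnorm_L1_simple mu (id : K -> K) qr) mulr_sumr.
    apply: le_trans (rnorm_sum _ _) _; apply: ler_sum => z _.
    rewrite linearZ rnormZ mulrC mulrA ler_wpM2r ?rnorm_ge0//.
    by apply: Pc; case: qr.
  have PfF : rnorm (P f - P F) <= M * rnorm (f - F) by rewrite -linearB.
  have Ff : rnorm F <= rnorm f + rnorm (f - F).
    by rewrite -[F in leLHS](subrK f) [leRHS]addrC (rdistC f) rnormD.
  have := rnormD (P f - P F) (P F); rewrite subrK => PfD.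
  have := ler_wpM2l c0 Ff; rewrite mulrDr mulrDl; lra.
have lim : (c * rnorm f + (M + c) * rnorm (f - L1_class mu (q n)))
    @[n --> \oo] --> c * rnorm f.
  rewrite -[X in _ --> X]addr0; apply: cvgD; first exact: cvg_cst.
  by rewrite -(mulr0 (M + c)); apply: cvgM => //; exact: cvg_cst.
rewrite -(cvg_lim _ lim)//; apply: limr_ge; first by apply/cvg_ex; eexists; exact: lim.
exact: nearW.
Qed.

End L1_density.

(** * The Bochner integral *)

Section bochner_estimate.
Context (R : realType) (k : scalar_kind) d (T : measurableType d).
Variable mu : probability T R.
Local Notation K := (scalar_field R k).
Local Notation m := (pmass mu).

(* g need not be measurable: its integral is the supremum of the integrals of
   the nonnegative simple functions below it. *)
Lemma ge0_le_lower_integral (f g : T -> \bar R) : (forall x, 0 <= f x)%E ->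
  (forall x, f x <= g x)%E -> (\int[mu]_x f x <= \int[mu]_x g x)%E.
Proof.
move=> f0 fg; have g0 x : (0 <= g x)%E := le_trans (f0 x) (fg x).
rewrite !ge0_integralE// !patch_setT; apply: ge_ereal_sup => _ [h/= hf <-].
by apply: ereal_sup_ubound; exists h => //= x; exact: le_trans (fg x).
Qed.

(** As g may fail to be measurable, it is left untouched: f is replaced by 0 on a measurable null
    set that contains the exceptional points. *)
Lemma ae_ge0_le_integral (f g : T -> \bar R) : measurable_fun setT f ->
  (forall x, 0 <= f x)%E -> (forall x, 0 <= g x)%E ->
  {ae mu, forall x, (f x <= g x)%E} ->
  (\int[mu]_x f x <= \int[mu]_x g x)%E.
Proof.
move=> mf f0 g0 [N [mN N0 fgN]].
pose f' := f \_ (~` N).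
have f'0 x : (0 <= f' x)%E by rewrite /f' /patch; case: ifP.
have -> : (\int[mu]_x f x = \int[mu]_x f' x)%E.
  apply: ge0_ae_eq_integral => //.
    apply: (measurable_restrictT _ _).1; first exact: measurableC.
    exact: measurable_funTS.
  exists N; split => // x /= /not_implyP[_]; apply: contra_notP => Nx.
  by rewrite /f' patchT// inE.
apply: ge0_le_lower_integral => // x; rewrite /f' /patch.
case: ifPn => // /set_mem; apply: contra_notP => fg; exact: fgN.
Qed.

(** The hypothesis makes h vanish almost everywhere off B. The approximants of h are compared with
    [v] times the indicator on the partition generated by [s n] and B, and the extra error is at
    most the integral of |h - s n|, which tends to 0. *)
Lemma bochner_integral_indic (Y : normedModType K) (h : T -> Y) (y v : Y)
    (B : set T) (e : R) :
  is_bochner_integral mu h y -> measurable B -> 0 <= e ->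
  {ae mu, forall x, rnorm (h x - of_real (\1_B x) *: v) <= e * \1_B x} ->
  rnorm (y - of_real (m B) *: v) <= e * m B.
Proof.
move=> [_ [s [ss sh sy]]] mB e0 hv.
pose vb (b : bool) : Y := of_real b%:R *: v.
pose dist (z : Y * bool) := rnorm (z.1 - vb z.2).
have B_int : m B = \sum_(b <- [:: true; false])
    m ((fun x => x \in B) @^-1` [set b]) * b%:R.
  rewrite !big_cons big_nil mulr0 !addr0 mulr1; congr m.
  by apply/seteqP; split=> x /=; rewrite -[B x]inE => ->.
have le_n n : ((rnorm (simple_integral mu (s n) - of_real (m B) *: v))%:E <=
    (e * m B)%:E + \int[mu]_x (rnorm (h x - s n x))%:E)%E.
  have [r sr] := (vector_simpleP (s n)).1 (ss n).
  have Br := simple_map_mem mB.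
  have pr := simple_map_pair sr Br; set p := (fun x => (_, _)) in pr.
  have -> : simple_integral mu (s n) - of_real (m B) *: v =
      \sum_(z <- allpairs pair r [:: true; false])
        of_real (m (p @^-1` [set z])) *: (z.1 - vb z.2).
    under eq_bigr do rewrite scalerBr.
    rewrite sumrB -(simple_integral_comp mu fst pr).
    rewrite -(simple_integral_comp mu (fun z => vb z.2) pr).
    rewrite (simple_integral_comp mu vb Br) B_int of_real_sum scaler_suml.
    by under [in RHS]eq_bigr do rewrite scalerA -of_realM.
  (* The excess of the distance over e on B, and over 0 off B. It is a nonnegative simple function
     dominated almost everywhere by |h - s n|, so [ae_ge0_le_integral] applies without measurability
     of the latter. *)
  pose phi z := Num.max 0 (dist z - e * z.2%:R).
  have phi0 z : 0 <= phi z by rewrite le_max lexx.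
  apply: (@le_trans _ _ (\sum_(z <- allpairs pair r [:: true; false])
      m (p @^-1` [set z]) * (e * z.2%:R) +
    \sum_(z <- allpairs pair r [:: true; false]) m (p @^-1` [set z]) * phi z)%:E).
    rewrite lee_fin; apply: le_trans (rnorm_sum _ _) _.
    rewrite -big_split/=; apply: ler_sum => z _.
    rewrite rnormZ rnorm_of_real ger0_norm ?pmass_ge0// -mulrDr.
    rewrite ler_wpM2l ?pmass_ge0// -lerBlDl le_max; apply/orP; right.
    exact: lexx.
  rewrite EFinD -(simple_map_integral mu pr); last first.
    by move=> z; rewrite mulr_ge0.
  rewrite (simple_map_integral mu (f := fun b : bool => e * b%:R) Br); last first.
    by move=> b; rewrite mulr_ge0.
  under eq_bigr do rewrite mulrCA.
  rewrite -mulr_sumr -B_int leeD2l// -(simple_map_integral mu pr)//.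
  apply: ae_ge0_le_integral.
  - by apply/measurable_EFinP; exact: (simple_map_measurable phi pr).
  - by move=> x; rewrite lee_fin.
  - by move=> x; rewrite lee_fin rnorm_ge0.
  apply: filterS hv => x hx; rewrite lee_fin /phi ge_max rnorm_ge0/=.
  rewrite lerBlDr; apply: le_trans (rdistD (h x) _ _) _; rewrite rdistC lerD2l.
  by rewrite indicE in hx.
apply/ler_addgt0Pr => a a0; have a20 : 0 < a / 2 by rewrite divr_gt0.
have /rnorm_cvgP /(_ _ a20) := sy.
have /fine_cvgP[fin /cvgrPdist_le /(_ _ a20)] := sh.
have [N _ Nfin] := fin => -[N1 _ Ne] [N2 _ Ny].
pose n := (N + N1 + N2)%N.
have nN : (N <= n)%N by rewrite /n -addnA leq_addr.
have nN1 : (N1 <= n)%N by rewrite /n addnAC leq_addl.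
have nN2 : (N2 <= n)%N by rewrite /n leq_addl.
have := le_n n; rewrite -(fineK (Nfin n nN)) -EFinD lee_fin => len.
have := Ne n nN1; rewrite /= sub0r normrN => /(le_trans (ler_norm _)) ne.
have := Ny n nN2 => /= ny.
have := rdistD (simple_integral mu (s n)) y (of_real (m B) *: v).
by move: len ne ny; lra.
Qed.

End bochner_estimate.

(** * Sets on which a representing function is almost constant *)

Section representable.
Context (R : realType) (k : scalar_kind) d (T : measurableType d).
Variables (mu : probability T R) (Y : normedModType (scalar_field R k)).
Local Notation K := (scalar_field R k).
Local Notation L1 := (L1 k mu).
Local Notation m := (pmass mu).

Lemma probability_ae_ex (P : set T) : {ae mu, forall x, P x} -> exists x, P x.
Proof.
move=> [N [mN N0 PN]]; apply: contrapT => /forallNP nP.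
have /seteqP[_ TN] : N = setT by apply/seteqP; split => // x _; exact/PN/nP.
have := @probability_setT _ _ _ mu.
rewrite (_ : setT = N); last by apply/seteqP; split.
by rewrite N0 => /eqP; rewrite eq_sym onee_eq0.
Qed.

(** By contradiction: otherwise every v that is e-close to g on some [A N v] of positive measure has
    norm below |S| - 2e. Then |g| <= |S| - e almost everywhere, and testing S on indicators yields
    |S| <= |S| - e. *)
Lemma representable_almost_constant (S : {linear L1 -> Y}) (e : R) :
  continuous S -> representable S -> 0 < e -> exists A v,
    [/\ measurable A, 0 < m A, opnorm S - 2 * e <= rnorm v &
        forall B, measurable B -> B `<=` A ->
          rnorm (S (L1_indic k mu B) - of_real (m B) *: v) <= e * m B].
Proof.
move=> cS [g [[s ss sg] _ Sg]] e0.
(* Almost every point lies in some A N (s N x), hence in one of countably many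
   sets on which g is within e of a constant. *)
pose A N v := \bigcap_(n in [set n | (N <= n)%N]) s n @^-1` [set w | rnorm (w - v) <= e].
have mA N v : measurable (A N v).
  apply: bigcap_measurable => [|n _]; first by exists N => /=.
  have [r sr] := (vector_simpleP (s n)).1 (ss n).
  exact: simple_map_preimage sr.
have close N v x : s n x @[n --> \oo] --> g x -> A N v x -> rnorm (g x - v) <= e.
  move=> /rnorm_cvgP sgx Ax; apply/ler_addgt0Pr => a a0.
  have [N' _ gN] := sgx _ a0; pose n := (N + N')%N.
  apply: le_trans (rdistD (s n x) _ _) _; rewrite addrC lerD//.
    by apply: Ax; rewrite /= leq_addr.
  by apply: gN; rewrite /= leq_addl.
have est B v a : measurable B -> 0 <= a ->
    {ae mu, forall x, B x -> rnorm (g x - v) <= a} ->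
    rnorm (S (L1_indic k mu B) - of_real (m B) *: v) <= a * m B.
  move=> mB a0 gv; apply: (bochner_integral_indic (Sg _)) => //.
  have indE := L1_classP (indic_integrable k mu mB).
  apply: filterS2 gv indE => x gv ->//.
  rewrite -scalerBr rnormZ rnorm_of_real indicE.
  case: (boolP (x \in B)) => [/set_mem /gv|_].
    by rewrite normr1 mul1r mulr1.
  by rewrite normr0 mul0r mulr0.
apply: contrapT => nA.
have small N v : mu (A N v) != 0%E -> rnorm v < opnorm S - 2 * e.
  move=> AN0; rewrite ltNge; apply/negP => vS; apply: nA; exists (A N v), v.
  split => //; first by rewrite -pmass_gt0// lt0e AN0 measure_ge0.
  move=> B mB BA; apply: est => //; first exact: ltW.
  by apply: filterS sg => x sgx /BA; exact: close.
have gS : {ae mu, forall x, rnorm (g x) <= opnorm S - e}.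
  have [r sr] := choice (fun n => (vector_simpleP (s n)).1 (ss n)).
  (* Values of the [s N] are enumerated by pairs of integers, so that countably many null sets are
     discarded at once. Beyond the end of [r N] the default 0 only adds further sets of the same
     kind. *)
  have null N i : {ae mu, forall x, mu (A N (nth 0 (r N) i)) = 0%E ->
      ~ A N (nth 0 (r N) i) x}.
    have [A0|/eqP A0] := eqVneq (mu (A N (nth 0 (r N) i))) 0%E.
      exists (A N (nth 0 (r N) i)); split=> // x /= nx.
      by apply: contrapT => nAx; apply: nx.
    by apply: aeW => x.
  have nulls := ae_foralln (fun N => ae_foralln (null N)).
  apply: filterS2 sg nulls => x sgx nullx.
  have /rnorm_cvgP /(_ (e / 2)) [|N _ gN] := sgx; first by rewrite divr_gt0.
  have AN : A N (s N x) x.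
    move=> n /= Nn; apply: le_trans (rdistD (g x) _ _) _.
    rewrite [leRHS]splitr lerD//; last exact: gN (leqnn N).
    by rewrite rdistC; exact: gN.
  have /small sN : mu (A N (s N x)) != 0%E.
    apply/eqP => A0; have [_ rN _] := sr N.
    have := nullx N (index (s N x) (r N)).
    by rewrite nth_index//; apply.
  have := close _ _ _ sgx AN; have := rnormD (g x - s N x) (s N x).
  by rewrite subrK; move: sN; lra.
(* A single such point shows |S| - e >= 0, as [bounded_op_indic] and [opnorm_le] require. *)
have [x gx] := probability_ae_ex gS.
have Se0 : 0 <= opnorm S - e := le_trans (rnorm_ge0 _) gx.
have Se : bounded_op S (opnorm S - e).
  apply: bounded_op_indic => // B mB; rewrite -[S _](subr0) -(scaler0 _ (of_real (m B))).
  apply: est => //; apply: filterS gS => z gz _.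
  by rewrite subr0.
by have := opnorm_le Se Se0; rewrite lerBrDr -subr_ge0 opprD addNKr oppr_ge0 leNgt e0.
Qed.

End representable.

(** * Integration over a measurable set *)

Section L1_integral.
Context (R : realType) (k : scalar_kind) d (T : measurableType d).
Variables (mu : probability T R) (A : set T).
Hypothesis mA : measurable A.
Local Notation K := (scalar_field R k).
Local Notation L1 := (L1 k mu).
Local Notation m := (pmass mu).

Definition L1_int (f : L1) : K :=
  of_real (\int[mu]_(x in A) re (f x)) +
  imag_unit R k * of_real (\int[mu]_(x in A) im (f x)).

Lemma re_L1_int f : re (L1_int f) = \int[mu]_(x in A) re (f x).
Proof. by rewrite reD re_of_real re_imag_unitM addr0. Qed.

Lemma im_L1_int f : im (L1_int f) = \int[mu]_(x in A) im (f x).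
Proof.
rewrite imD im_of_real add0r imM im_of_real mulr0 add0r re_of_real.
(* Over the reals [imag_unit] is 0, so the left side loses the integral; the right side is 0 because
   [im] is. *)
set h := (fun x => im (f x)); have : k = RealScalars -> h = cst 0.
  by rewrite {}/h; move: (f : T -> K) => /= {f}; case: k.
rewrite /im /imag_unit; case: k => /= [->//|_]; last by rewrite mul1r.
by rewrite mul0r /Rintegral integral0.
Qed.

Lemma L1_reim_integrable (D : set T) (f : L1) : measurable D ->
  mu.-integrable D (EFin \o (re \o f)) /\ mu.-integrable D (EFin \o (im \o f)).
Proof.
move=> mD.
have /andP[/= /Lfun1_integrable rf /Lfun1_integrable imf] := L1_repr_integrable f.
by split; exact: (integrableS measurableT).
Qed.

Lemma Rintegral_ae_eq (f g : T -> R) :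
  mu.-integrable A (EFin \o f) -> mu.-integrable A (EFin \o g) ->
  {ae mu, forall x, f x = g x} ->
  \int[mu]_(x in A) f x = \int[mu]_(x in A) g x.
Proof.
move=> If Ig fg; congr fine; apply: ae_eq_integral => //.
- exact: measurable_int If.
- exact: measurable_int Ig.
- by apply: filterS fg => x ->.
Qed.

Lemma L1_intD f g : L1_int (f + g) = L1_int f + L1_int g.
Proof.
have [If Jf] := L1_reim_integrable f mA.
have [Ig Jg] := L1_reim_integrable g mA.
have [Ifg Jfg] := L1_reim_integrable (f + g) mA.
apply: scalar_ext.
  rewrite reD !re_L1_int -RintegralD//; apply: Rintegral_ae_eq => //.
    exact: (integrableD mA If Ig).
  by apply: filterS (L1_reprD f g) => x ->//; rewrite reD.
rewrite imD !im_L1_int -RintegralD//; apply: Rintegral_ae_eq => //.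
  exact: (integrableD mA Jf Jg).
by apply: filterS (L1_reprD f g) => x ->//; rewrite imD.
Qed.

Lemma L1_intZ a f : L1_int (a *: f) = a * L1_int f.
Proof.
have [If Jf] := L1_reim_integrable f mA.
have [Iaf Jaf] := L1_reim_integrable (a *: f) mA.
have IZ (u : T -> R) b : mu.-integrable A (EFin \o u) ->
    mu.-integrable A (EFin \o (fun x => b * u x)).
  exact: (integrableZl mA b).
apply: scalar_ext.
  rewrite reM !re_L1_int !im_L1_int -mulNr -!RintegralZl//.
  rewrite -RintegralD//; [|exact: IZ..]; apply: Rintegral_ae_eq => //.
    exact: (integrableD mA (IZ _ _ If) (IZ _ _ Jf)).
  by apply: filterS (L1_reprZ a f) => x ->//; rewrite reM mulNr.
rewrite imM !re_L1_int !im_L1_int -!RintegralZl//.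
rewrite -RintegralD//; [|exact: IZ..]; apply: Rintegral_ae_eq => //.
  exact: (integrableD mA (IZ _ _ Jf) (IZ _ _ If)).
by apply: filterS (L1_reprZ a f) => x ->//; rewrite imM.
Qed.

(** The factor 2 comes from bounding the two parts separately; the estimate serves continuity
    only. *)
Lemma rnorm_L1_int f : rnorm (L1_int f) <= 2 * rnorm f.
Proof.
have [If Jf] := L1_reim_integrable f mA.
have nf : mu.-integrable setT (fun x => (rnorm (f x))%:E) := integrable_rnorm _.
have le (u : K -> R) : mu.-integrable A (EFin \o (u \o f)) ->
    (forall z, `|u z| <= rnorm z) ->
    `|\int[mu]_(x in A) u (f x)| <= rnorm f.
  move=> iu un; apply: le_trans (le_normr_Rintegral mA iu) _.
  have niu : mu.-integrable A (fun x => `|u (f x)|%:E) := integrable_norm iu.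
  rewrite rnorm_L1; apply: fine_le.
  - exact: integrable_fin_num niu.
  - exact: integrable_fin_num nf.
  apply: (@le_trans _ _ (\int[mu]_(x in A) (rnorm (f x))%:E)%E).
    apply: ge0_le_integral => //.
    - exact: measurable_int niu.
    - exact: measurable_int (integrableS measurableT mA (@subsetT _ _) nf).
    - by move=> x _; rewrite lee_fin; exact: un.
  apply: ge0_subset_integral => //; first exact: measurable_int nf.
  by move=> x _; rewrite lee_fin rnorm_ge0.
apply: le_trans (rnorm_le _) _; rewrite re_L1_int im_L1_int mulr_natl mulr2n.
apply: lerD; first exact: (le _ If (@ler_re_rnorm _ _)).
exact: (le _ Jf (@ler_im_rnorm _ _)).
Qed.

Lemma L1_int_indic B : measurable B ->
  L1_int (L1_indic k mu B) = of_real (m (B `&` A)).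
Proof.
move=> mB; have [I1 J1] := L1_reim_integrable (L1_indic k mu B) mA.
have ind := L1_classP (indic_integrable k mu mB).
have /andP[/= /Lfun1_integrable I2 /Lfun1_integrable J2] :=
  indic_integrable k mu mB.
have {}I2 := integrableS measurableT mA (@subsetT _ _) I2.
have {}J2 := integrableS measurableT mA (@subsetT _ _) J2.
apply: scalar_ext.
  rewrite re_of_real re_L1_int (Rintegral_ae_eq I1 I2); last first.
    by apply: filterS ind => x /= ->.
  rewrite /Rintegral; under eq_integral do rewrite /= re_of_real.
  by rewrite integral_indic.
rewrite im_of_real im_L1_int (Rintegral_ae_eq J1 J2); last first.
  by apply: filterS ind => x /= ->.
rewrite /Rintegral; under eq_integral do rewrite /= im_of_real.
by rewrite integral0.
Qed.

Lemma L1_int_linear (Y : normedModType K) (y : Y) :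
  linear (fun f => L1_int f *: y).
Proof. by move=> a f g; rewrite L1_intD L1_intZ scalerDl scalerA. Qed.

End L1_integral.

(** * The alternative Daugavet property and spear sets *)

Section spear.
Context (R : realType) (k : scalar_kind) d (T : measurableType d).
Variables (mu : probability T R) (Y : normedModType (scalar_field R k)).
Variables (G : {linear L1 k mu -> Y}).
Hypotheses (cG : continuous G) (G1 : opnorm G = 1).
Local Notation K := (scalar_field R k).
Local Notation L1 := (L1 k mu).
Local Notation m := (pmass mu).

Lemma norm_one_le f : rnorm (G f) <= rnorm f.
Proof.
have [M M0 GM] := continuous_bounded_op cG.
rewrite -[leRHS]mul1r -G1; apply: (bounded_op_opnorm _ M0 GM) => a x.
exact: linearZ.
Qed.

Lemma norm_one_exists_neq0 : exists y : Y, y != 0.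
Proof.
apply: contrapT => /forallNP Y0.
have /opnorm_le : bounded_op G 0.
  by move=> f; have /negP/negPn/eqP -> := Y0 (G f); rewrite rnorm0 mul0r.
by rewrite G1 ler10 lexx => /(_ isT).
Qed.

Lemma Gamma_image A z : (G @` Gamma k mu A) z <->
  exists B, [/\ measurable B, B `<=` A, 0 < m B &
    z = of_real (m B)^-1 *: G (L1_indic k mu B)].
Proof.
split=> [[_ [B [mB BA B0] <-] <-]|[B [mB BA B0 ->]]].
  exists B; split => //; first by rewrite -pmass_gt0.
  by rewrite Gamma_elt// linearZ.
rewrite -linearZ -Gamma_elt//; eexists => //; exists B => //.
by split => //; rewrite pmass_gt0.
Qed.

Lemma rnorm_of_realV (a : R) : 0 < a -> rnorm (of_real a^-1 : K) = a^-1.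
Proof. by move=> a0; rewrite rnorm_of_real ger0_norm// invr_ge0 ltW. Qed.

Lemma of_realVK (V : normedModType K) (a : R) (v : V) : 0 < a ->
  of_real a *: (of_real a^-1 *: v) = v.
Proof.
by move=> a0; rewrite scalerA -of_realM mulfV ?gt_eqF// of_real1 scale1r.
Qed.

Lemma of_realKV (V : normedModType K) (a : R) (v : V) : 0 < a ->
  of_real a^-1 *: (of_real a *: v) = v.
Proof.
by move=> a0; rewrite scalerA -of_realM mulVf ?gt_eqF// of_real1 scale1r.
Qed.

Lemma Gamma_image_ball A : G @` Gamma k mu A `<=` [set z | rnorm z <= 1].
Proof.
move=> _ /Gamma_image[B [mB _ B0 ->]] /=.
rewrite rnormZ rnorm_of_realV// ler_pdivrMl// mulr1.
by rewrite -(rnorm_L1_indic k mu mB) norm_one_le.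
Qed.

Lemma Gamma_image_nonempty A : measurable A -> 0 < m A ->
  G @` Gamma k mu A !=set0.
Proof.
move=> mA A0; exists (of_real (m A)^-1 *: G (L1_indic k mu A)).
by apply/Gamma_image; exists A; split.
Qed.

Lemma alt_Daugavet_spear A : alt_Daugavet_property G -> measurable A ->
  (0 < mu A)%E -> spear_set (G @` Gamma k mu A).
Proof.
move=> GD mA; rewrite pmass_gt0// => A0.
apply/spear_setP; [exact: Gamma_image_nonempty|exact: Gamma_image_ball|].
(* Only y != 0 yields a rank-one operator; y = 0 is deduced at the end. *)
have spear y e : y != 0 -> 0 < e -> exists w z,
    [/\ unit_scalars w, (G @` Gamma k mu A) z &
        1 + rnorm y - e < rnorm (z + w *: y)].
  move=> y0 e0; apply: contrapT => ney.
  have {ney}le w z : unit_scalars w -> (G @` Gamma k mu A) z ->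
      rnorm (z + w *: y) <= 1 + rnorm y - e.
    by move=> w1 Fz; rewrite leNgt; apply/negP => lt; apply: ney; exists w, z.
  have [S SE] : exists S : {linear L1 -> Y}, forall f, S f = L1_int A f *: y.
    exact: linear_map_of (L1_int_linear mA y).
  have cS : continuous S.
    apply: (@bounded_op_continuous _ _ _ _ _ (2 * rnorm y)) => f.
    by rewrite SE rnormZ mulrAC ler_wpM2r ?rnorm_ge0// rnorm_L1_int.
  have rS : rank_one S.
    exists y => //; apply/seteqP; split => [_ [f _ <-]|_ [a _ <-]].
      by exists (L1_int A f).
    exists (a *: (of_real (m A)^-1 *: L1_indic k mu A)) => //.
    rewrite !linearZ/= SE L1_int_indic// setIid.
    by rewrite of_realKV.
  (* Tested on the normalized indicator of A, which S sends to y. *)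
  have yS : rnorm y <= opnorm S.
    have [M M0 SM] := continuous_bounded_op cS.
    have := opnorm_ub SM M0 (x := of_real (m A)^-1 *: L1_indic k mu A).
    rewrite linearZ/= SE L1_int_indic// setIid of_realKV//; apply.
    by rewrite rnormZ rnorm_of_realV// rnorm_L1_indic// mulVf// gt_eqF.
  have ny0 : 0 < rnorm y.
    by rewrite lt_def rnorm_ge0 andbT; apply: contra_neq y0 => /rnorm_eq0.
  pose c := Num.max 1 (1 + rnorm y - e).
  have c1 : 1 <= c by rewrite le_max lexx.
  have c0 : 0 <= c := le_trans ler01 c1.
  have /(alt_Daugavet_eqP cG cS G1) := GD S cS rS.
  (* Since |y| <= |S|, this tolerance places both branches of c below 1 + |S| - min(e, |y|): the
     branch 1 because of |y|, the other because of e. *)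
  move=> /(_ (Num.min e (rnorm y))) [|w [f [w1 f1]]].
    by rewrite lt_min e0.
  have [P PE] : exists P : {linear L1 -> Y}, forall g, P g = G g + w *: S g.
    by exists (G \+ (w \*: S)).
  have cP : continuous P.
    apply: (@bounded_op_continuous _ _ _ _ P (opnorm G + opnorm S)) => g.
    by rewrite PE; exact: opnormD.
  have Pc : bounded_op P c.
    apply: bounded_op_indic => // B mB.
    have Gle C : measurable C -> rnorm (G (L1_indic k mu C)) <= m C.
      by move=> mC; rewrite -(rnorm_L1_indic k mu mC) norm_one_le.
    have mBA := measurableI _ _ mB mA; have mBD := measurableD mB mA.
    have BE : B = (B `&` A) `|` (B `\` A) by rewrite setUIDK.
    have BI : B `&` A `&` (B `\` A) = set0 by rewrite setDE setIACA setICr setI0.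
    have -> : P (L1_indic k mu B) =
        P (L1_indic k mu (B `&` A)) + P (L1_indic k mu (B `\` A)).
      by rewrite -linearD -L1_indicU// -BE.
    have -> : m B = m (B `&` A) + m (B `\` A) by rewrite -pmassU// -BE.
    rewrite mulrDr.
    apply: le_trans (rnormD _ _) (lerD _ _); last first.
      rewrite PE SE L1_int_indic// setDE -setIA setICl setI0 pmass0 of_real0.
      rewrite scale0r scaler0 addr0; apply: le_trans (Gle _ mBD) _.
      by rewrite ler_peMl// pmass_ge0.
    rewrite PE SE L1_int_indic// -setIA setIid.
    (* A null set has no normalized indicator, but then S vanishes on it and the bound on G
       suffices. *)
    have [BA0|BA0] := eqVneq (m (B `&` A)) 0.
      rewrite BA0 of_real0 scale0r scaler0 addr0 mulr0 -BA0; exact: Gle.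
    have {}BA0 : 0 < m (B `&` A) by rewrite lt_def BA0 pmass_ge0.
    rewrite scalerA [w * _]mulrC -scalerA -[G _](of_realVK _ BA0) -scalerDr rnormZ rnorm_of_real.
    rewrite ger0_norm ?pmass_ge0// mulrC ler_wpM2r ?pmass_ge0//.
    rewrite le_max le ?orbT//; apply/Gamma_image; exists (B `&` A).
    by split.
  apply/negP; rewrite -leNgt -PE; apply: le_trans (Pc f) _.
  apply: le_trans (ler_piMr c0 f1) _; rewrite ge_max.
  move: yS; set t := opnorm _; case: (leP e (rnorm y)); lra.
(* For y = 0, any u != 0 gives |z + w u| > 1 + |u| - e, hence |z| > 1 - e. *)
move=> y e e0; have [->|] := eqVneq y 0; last by move=> y0; exact: spear.
have [u u0] := norm_one_exists_neq0.
have [w [z [w1 Fz uz]]] := spear u e u0 e0.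
exists w, z; split => //; rewrite scaler0 addr0 rnorm0 addr0.
by have := rnormD z (w *: u); rewrite rnormZ_unit//; move: uz; lra.
Qed.

Lemma spear_representable :
  (forall A, measurable A -> (0 < mu A)%E -> spear_set (G @` Gamma k mu A)) ->
  forall S : {linear L1 -> Y}, continuous S -> representable S ->
    alt_Daugavet_eq G S.
Proof.
move=> Gs S cS rS; apply/alt_Daugavet_eqP => // e e0.
(* Two quarters are lost between |v| and |S|, one in the spear property, and one in replacing v by
   the value of S. *)
have e40 : 0 < e / 4 by rewrite divr_gt0.
have [A [v [mA A0 Sv near_v]]] := representable_almost_constant cS rS e40.
have /spear_setP sp : spear_set (G @` Gamma k mu A).
  by apply: Gs; rewrite ?pmass_gt0.
have [w [_ [w1 /Gamma_image[B [mB BA B0 ->]] zv]]] :=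
  sp (Gamma_image_nonempty mA A0) (@Gamma_image_ball A) v _ e40.
exists w, (of_real (m B)^-1 *: L1_indic k mu B); split => //.
  by rewrite rnormZ rnorm_of_realV// rnorm_L1_indic// mulVf// gt_eqF.
have Bv : rnorm (S (of_real (m B)^-1 *: L1_indic k mu B) - v) <= e / 4.
  rewrite linearZ/= -{1}(of_realKV v B0) -scalerBr rnormZ rnorm_of_realV//.
  by rewrite ler_pdivrMl// mulrC near_v.
rewrite [G _]linearZ /=.
set z := of_real _ *: G _ in zv *; set Sf := S _ in Bv *.
have := rnormD (z + w *: Sf) (w *: (v - Sf)).
rewrite -addrA -scalerDr [Sf + _]addrC subrK rnormZ_unit// rdistC.
by move: zv Bv Sv; lra.
Qed.

End spear.

(** * Densities of bounded functionals *)

Lemma additive_tail d (T : measurableType d) (R : zmodType) (rho : set T -> R)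
    (F : nat -> set T) n :
  (forall A B, measurable A -> measurable B -> A `&` B = set0 ->
    rho (A `|` B) = rho A + rho B) ->
  (forall i, measurable (F i)) -> trivIset setT F ->
  rho (\bigcup_i F i) = \sum_(0 <= i < n) rho (F i) +
    rho (\bigcup_(i in [set i | (n <= i)%N]) F i).
Proof.
move=> rhoU mF tF; elim: n => [|n IHn].
  rewrite big_geq// add0r; congr rho; apply: eq_bigcupl.
  by split.
rewrite IHn big_nat_recr//= -addrA; congr (_ + _).
rewrite -rhoU//.
- congr rho; apply/seteqP; split => [x [i /= ni Fx]|x [Fx|[i /= ni Fx]]].
  + move: ni; rewrite leq_eqVlt => /orP[/eqP ->|ni]; first by left.
    by right; exists i.
  + by exists n => /=.
  + by exists i => //=; exact: ltnW.
- by apply: bigcup_measurable => i _.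
- apply/seteqP; split => // x [Fn [i /= ni Fi]].
  by move: ni; rewrite -(tF n i I I) ?ltnn//; exists x.
Qed.

Section density.
Context (R : realType) d (T : measurableType d).
Variable mu : probability T R.
Local Notation m := (pmass mu).
Variables (nu : set T -> R) (M : R).
Hypothesis nuU : forall A B, measurable A -> measurable B -> A `&` B = set0 ->
  nu (A `|` B) = nu A + nu B.
Hypothesis nuM : forall A, measurable A -> `|nu A| <= M * m A.

(** Countable additivity is inherited from mu: by finite additivity the error after n terms is nu of
    the tail, which [nuM] bounds by M times the mass of the tail. *)
Let nu_sigma_additive : semi_sigma_additive (fun A => (nu A)%:E).
Proof.
move=> F mF tF mUF; apply: cvg_EFin; first by apply: nearW => n; rewrite sumEFin.
have mF_cvg : \sum_(0 <= i < n) m (F i) @[n --> \oo] --> m (\bigcup_i F i).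
  have : (\sum_(0 <= i < n) mu (F i))%E @[n --> \oo] --> mu (\bigcup_i F i).
    exact: measure_semi_sigma_additive.
  rewrite -(pmassE mu mUF) => /fine_cvg; apply: cvg_trans; apply: near_eq_cvg.
  apply: nearW => n; rewrite -[RHS]/(fine (\sum_(0 <= i < n) m (F i))%:E).
  by rewrite -sumEFin; congr fine; apply: eq_bigr => i _; rewrite pmassE.
apply/cvgrPdist_le => e e0.
have M10 : 0 < `|M| + 1 by rewrite ltr_wpDl.
have /cvgrPdist_le /(_ (e / (`|M| + 1))) [|N _ Ne] := mF_cvg.
  by rewrite divr_gt0.
exists N => // n /Ne /=; rewrite sumEFin/=.
have mtail : measurable (\bigcup_(i in [set i | (n <= i)%N]) F i).
  by apply: bigcup_measurable => i _.
rewrite (additive_tail n nuU)// (additive_tail n (@pmassU _ _ _ mu))//.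
rewrite ![_ + _ - _]addrC !addKr ger0_norm ?pmass_ge0//.
rewrite ler_pdivlMr// mulrC => me; apply: le_trans (nuM mtail) (le_trans _ me).
by rewrite ler_wpM2r ?pmass_ge0// (le_trans (ler_norm _))// lerDl.
Qed.

(** The density is recorded by one-sided estimates on sets instead of an integral formula, which is
    the form that rounding exploits, and its bound holds at every point. *)
Lemma bounded_density : exists g : T -> R,
  [/\ measurable_fun setT g, forall x, `|g x| <= M,
      forall a B, measurable B -> (forall x, B x -> a <= g x) -> a * m B <= nu B &
      forall b B, measurable B -> (forall x, B x -> g x <= b) -> nu B <= b * m B].
Proof.
have M0 : 0 <= M.
  have := nuM measurableT; rewrite /pmass probability_setT mulr1.
  exact: le_trans.
pose nuE A := (nu A)%:E.
have nuR0 : nu set0 = 0.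
  by have := nuM measurable0; rewrite pmass0 mulr0 normr_le0 => /eqP.
have nu0 : nuE set0 = 0%E by rewrite /nuE nuR0.
have nufin A : measurable A -> nuE A \is a fin_num by [].
pose c : {charge set T -> \bar R} := HB.pack nuE
  (isCharge.Build _ _ _ nuE nu0 nufin nu_sigma_additive).
have c_mu : c `<< mu.
  move=> N N0 A mA AN; have A0 := N0 A mA AN.
  have := nuM mA; rewrite /pmass A0 mulr0 normr_le0 => /eqP nuA.
  by rewrite [LHS]/(nuE A) /nuE nuA.
pose h := fine \o Radon_Nikodym c mu.
have ih D : measurable D -> mu.-integrable D (EFin \o h).
  move=> mD; apply: (integrableS measurableT) => //.
  rewrite (_ : _ \o _ = Radon_Nikodym c mu); first exact: Radon_Nikodym_integrable.
  by apply/funext => x /=; rewrite fineK// Radon_Nikodym_fin_num.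
have nuh D : measurable D -> nu D = \int[mu]_(x in D) h x.
  move=> mD; apply: EFin_inj; rewrite -[LHS]/(c D) (Radon_Nikodym_integral c_mu mD).
  rewrite /Rintegral fineK; last exact: integrable_fin_num (ih _ mD).
  by apply: eq_integral => x _ /=; rewrite fineK// Radon_Nikodym_fin_num.
have mh : measurable_fun setT h by apply/measurable_EFinP; exact: measurable_int (ih _ measurableT).
(* The estimates of h survive clamping: where h is outside [- M, M], they are
   replaced by nuM. *)
pose g x := Num.max (- M) (Num.min M (h x)).
have cint D a : measurable D -> mu.-integrable D (EFin \o cst a).
  by move=> mD; exact: finite_measure_integrable_cst.
have sub D b : measurable D -> b * m D = \int[mu]_(x in D) b.
  by move=> mD; rewrite Rintegral_cst.
have lo a B : measurable B -> (forall x, B x -> a <= h x) -> a * m B <= nu B.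
  move=> mB ah; rewrite sub// nuh//; apply: le_Rintegral => //; [exact: cint|exact: ih].
have hi b B : measurable B -> (forall x, B x -> h x <= b) -> nu B <= b * m B.
  move=> mB hb; rewrite sub// nuh//; apply: le_Rintegral => //; [exact: ih|exact: cint].
have splits (rho : set T -> R) B E : (forall A B, measurable A -> measurable B ->
    A `&` B = set0 -> rho (A `|` B) = rho A + rho B) ->
    measurable B -> measurable E -> rho B = rho (B `&` E) + rho (B `\` E).
  move=> rhoU mB mE; rewrite -rhoU ?setUIDK//; [exact: measurableI|exact: measurableD|].
  by rewrite setDE setIACA setICr setI0.
have mU := @pmassU _ _ _ mu.
exists g; split.
- by apply: measurable_maxr => //; exact: measurable_minr.
- move=> x; rewrite ler_norml le_max lexx/= ge_max ge_min lexx/= andbT.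
  by rewrite ge0_cp.
- move=> a B mB ag; pose E := [set x | a <= h x].
  have mE : measurable E.
    by rewrite -[E]setTI; exact: (measurable_fun_le (f := cst a)).
  rewrite (splits m B E)// (splits nu B E)// mulrDr lerD//.
    by apply: lo => [|x []//]; exact: measurableI.
  have mBE : measurable (B `\` E) by exact: measurableD.
  have [->|/set0P[x [Bx /negP hx]]] := eqVneq (B `\` E) set0.
    by rewrite pmass0 mulr0 nuR0.
  (* At x, h x < a <= g x, so the clamp is active from below and g x = - M. *)
  have aM : a <= - M.
    have := ag _ Bx; rewrite /g le_max => /orP[//|].
    by rewrite le_min => /andP[_ ah]; case/negP: hx.
  have := nuM mBE; rewrite ler_norml => /andP[+ _]; apply: le_trans.
  by rewrite -mulNr ler_wpM2r// pmass_ge0.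
- move=> b B mB gb; pose E := [set x | h x <= b].
  have mE : measurable E.
    by rewrite -[E]setTI; exact: (measurable_fun_le (g := cst b)).
  rewrite (splits m B E)// (splits nu B E)// mulrDr lerD//.
    by apply: hi => [|x []//]; exact: measurableI.
  have mBE : measurable (B `\` E) by exact: measurableD.
  have [->|/set0P[x [Bx /negP hx]]] := eqVneq (B `\` E) set0.
    by rewrite pmass0 mulr0 nuR0.
  have Mb : M <= b.
    have := gb _ Bx; rewrite /g ge_max ge_min => /andP[_ /orP[//|hb]].
    by case/negP: hx.
  have := nuM mBE; rewrite ler_norml => /andP[_]; move=> /le_trans; apply.
  by rewrite ler_wpM2r// pmass_ge0.
Qed.

(** The last clause stands in for integration against g: where [u n] is constant, nu is that
    constant times mu up to a uniform relative error. *)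
Lemma simple_bounded_density : exists (g : T -> R) (u : nat -> T -> R),
  [/\ forall x, `|g x| <= M, forall n, exists r, simple_map (u n) r,
      forall n x, `|g x - u n x| <= harmonic n &
      forall n B c, measurable B -> (forall x, B x -> u n x = c) ->
        `|nu B - c * m B| <= harmonic n * m B].
Proof.
have [g [mg gM lo hi]] := bounded_density.
(* g is rounded down to a grid of step [harmonic n], that is 1/(n+1), starting at - M; the shift by
   M makes the argument of [truncn] nonnegative. *)
pose t n x := Num.truncn ((g x + M) * n.+1%:R).
pose u n x : R := (t n x)%:R * harmonic n - M.
have h0 n : 0 < harmonic n :> R by rewrite invr_gt0.
have gM0 n x : 0 <= (g x + M) * n.+1%:R.
  rewrite mulr_ge0// -lerBlDr sub0r; by have := gM x; rewrite ler_norml => /andP[].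
have ug n x : u n x <= g x <= u n x + harmonic n.
  have /andP[tg gt] := truncn_itv (gM0 n x); rewrite -/(t n x) in tg gt.
  have gE : (g x + M) * n.+1%:R * harmonic n = g x + M by rewrite mulfK.
  move: tg gt; rewrite -(ler_pM2r (h0 n)) gE -(ltr_pM2r (h0 n)) gE.
  by rewrite -natr1 mulrDl mul1r /u; move=> tg gt; apply/andP; split; lra.
exists g, u; split => //.
- move=> n; have [N tN] : exists N, forall x, (t n x < N)%N.
    exists (Num.truncn (2 * M * n.+1%:R)).+1 => x.
    rewrite ltnS; apply: le_truncn; rewrite ler_wpM2r//.
    by have := gM x; rewrite ler_norml => /andP[_]; lra.
  have tn : simple_map (t n) (iota 0 N).
    split; [exact: iota_uniq|by move=> x; rewrite mem_iota tN|].
    move=> i.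
    rewrite (_ : _ @^-1` _ = [set x | i%:R <= (g x + M) * n.+1%:R] `\`
      [set x | i.+1%:R <= (g x + M) * n.+1%:R]).
      have mf : measurable_fun setT (fun x => (g x + M) * n.+1%:R).
        by apply: measurable_funM => //; exact: measurable_funD.
      apply: measurableD; rewrite -[X in measurable X]setTI.
        exact: (measurable_fun_le (f := cst i%:R)).
      exact: (measurable_fun_le (f := cst i.+1%:R)).
    apply/seteqP; split => [x /= <-|x /= [xi /negP ix]].
      by have /andP[? ?] := truncn_itv (gM0 n x); split => //; apply/negP; rewrite -ltNge.
    by apply: truncn_def; rewrite xi/= ltNge.
  by eexists; exact: (simple_map_comp (fun i : nat => i%:R * harmonic n - M) tn).
- move=> n x; have /andP[ug1 ug2] := ug n x.
  by rewrite ger0_norm ?subr_ge0// lerBlDr addrC.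
- move=> n B c mB Bc.
  have lc : forall x, B x -> c <= g x.
    by move=> x Bx; rewrite -(Bc x Bx); case/andP: (ug n x).
  have hc : forall x, B x -> g x <= c + harmonic n.
    by move=> x Bx; rewrite -(Bc x Bx); case/andP: (ug n x).
  have := lo _ _ mB lc; have := hi _ _ mB hc; rewrite mulrDl => h1 h2.
  by rewrite ger0_norm ?subr_ge0// lerBlDr addrC.
Qed.

End density.

(** * Representability of rank-one operators *)

Section rank_one.
Context (R : realType) (k : scalar_kind) d (T : measurableType d).
Variables (mu : probability T R) (Y : normedModType (scalar_field R k)).
Local Notation K := (scalar_field R k).
Local Notation L1 := (L1 k mu).
Local Notation m := (pmass mu).

(** As y != 0, coefficients are unique, so those picked by choice depend linearly on x. *)
Lemma rank_one_functional (X : lmodType K) (S : {linear X -> Y}) (y : Y) :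
  y != 0 -> (forall x, exists a, S x = a *: y) ->
  exists phi : X -> K, (forall x, S x = phi x *: y) /\
    forall a x x', phi (a *: x + x') = a * phi x + phi x'.
Proof.
move=> y0 /choice[phi Sphi]; exists phi; split=> // a x x'.
apply/eqP; rewrite -subr_eq0; have : (phi (a *: x + x') - (a * phi x + phi x')) *: y == 0.
  by rewrite scalerBl scalerDl -scalerA -!Sphi linearP subrr.
by rewrite scaler_eq0 (negbTE y0) orbF.
Qed.

Definition pair_scalar (z : R * R) : K :=
  of_real z.1 + imag_unit R k * of_real z.2.

(** Real and imaginary parts of phi on indicators are two real set functions with densities; each
    factor 2 adds up their bounds or errors. *)
Lemma functional_density (phi : L1 -> K) (M : R) :
  (forall f f', phi (f + f') = phi f + phi f') ->
  (forall f, rnorm (phi f) <= M * rnorm f) ->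
  exists (g : T -> K) (p : nat -> T -> R * R),
  [/\ forall x, rnorm (g x) <= 2 * M,
      forall n, exists r, simple_map (p n) r,
      forall n x, rnorm (g x - pair_scalar (p n x)) <= 2 * harmonic n &
      forall n B z, measurable B -> (forall x, B x -> p n x = z) ->
        rnorm (phi (L1_indic k mu B) - pair_scalar z * of_real (m B)) <=
        2 * harmonic n * m B].
Proof.
move=> phiD phiM.
have bound (u : K -> R) B : (forall z, `|u z| <= rnorm z) -> measurable B ->
    `|u (phi (L1_indic k mu B))| <= M * m B.
  by move=> un mB; apply: le_trans (un _) _; rewrite -(rnorm_L1_indic k mu mB).
have [|B mB|g1 [u1 [g1M u1s u1g u1nu]]] := @simple_bounded_density R d T mu
    (fun B => re (phi (L1_indic k mu B))) M.
- by move=> A B mA mB AB; rewrite L1_indicU// phiD reD.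
- exact: (bound _ _ (@ler_re_rnorm _ _)).
have [|B mB|g2 [u2 [g2M u2s u2g u2nu]]] := @simple_bounded_density R d T mu
    (fun B => im (phi (L1_indic k mu B))) M.
- by move=> A B mA mB AB; rewrite L1_indicU// phiD imD.
- exact: (bound _ _ (@ler_im_rnorm _ _)).
have pair_le (a b : R) : rnorm (pair_scalar (a, b)) <= `|a| + `|b|.
  apply: le_trans (rnormD _ _) _; rewrite rnorm_of_real/= lerD2l.
  by rewrite rnormM rnorm_of_real ler_piMl// rnorm_imag_unit.
have pairB a b a' b' : pair_scalar (a, b) - pair_scalar (a', b') =
    pair_scalar (a - a', b - b').
  by rewrite /pair_scalar/= opprD addrACA -mulrBr -!of_realN -!of_realD.
have dbl (a : R) : 2 * a = a + a by rewrite mulr_natl mulr2n.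
exists (fun x => pair_scalar (g1 x, g2 x)), (fun n x => (u1 n x, u2 n x)).
split.
- by move=> x; apply: le_trans (pair_le _ _) _; rewrite dbl lerD.
- move=> n; have [r1 ?] := u1s n; have [r2 ?] := u2s n.
  by eexists; apply: simple_map_pair; eassumption.
- by move=> n x; rewrite pairB; apply: le_trans (pair_le _ _) _; rewrite dbl lerD.
- move=> n B [a b] mB Bz.
  have -> : pair_scalar (a, b) * of_real (m B) = pair_scalar (a * m B, b * m B).
    by rewrite /pair_scalar/= mulrDl -mulrA -!of_realM.
  apply: le_trans (rdist_scalar _ _ _) _; rewrite -mulrA dbl lerD//.
    by apply: u1nu => // x /Bz[].
  by apply: u2nu => // x /Bz[].
Qed.

(** The approximants of the integrand are the products of [q n], close to f in L1, with [p n],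
    uniformly close to the density. On a common fibre both are constant, and there phi of the
    indicator is almost the value of [p n] times the mass. *)
Lemma functional_representable (S : {linear L1 -> Y}) (y : Y) (phi : L1 -> K) :
  continuous S -> y != 0 -> (forall f, S f = phi f *: y) ->
  (forall f f', phi (f + f') = phi f + phi f') -> representable S.
Proof.
move=> cS y0 Sphi phiD; have [M M0 SM] := continuous_bounded_op cS.
have ny0 : 0 < rnorm y.
  by rewrite lt_def rnorm_ge0 andbT; apply: contra_neq y0 => /rnorm_eq0.
have [N N0 phiN] : exists2 N, 0 <= N & forall f, rnorm (phi f) <= N * rnorm f.
  exists (M / rnorm y); first by rewrite divr_ge0// ltW.
  by move=> f; rewrite mulrAC ler_pdivlMr// -rnormZ -Sphi.
have [g [p [gN ps pg pphi]]] := functional_density phiD phiN.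
have p_cvg x : pair_scalar (p n x) @[n --> \oo] --> g x.
  apply: (@rnorm_cvg0_le _ _ _ _ _ (fun n => 2 * harmonic n)) => [n|]; first exact: pg.
  by rewrite -(mulr0 2); apply: cvgM; [exact: cvg_cst|exact: cvg_harmonic].
exists (fun x => g x *: y); split.
- exists (fun n x => pair_scalar (p n x) *: y).
    move=> n; apply/vector_simpleP; have [r pr] := ps n.
    by eexists; exact: (simple_map_comp (fun z => pair_scalar z *: y) pr).
  by apply: aeW => x; apply: cvgZr_tmp; exact: p_cvg.
- apply: (@le_lt_trans _ _ (2 * N * rnorm y)%:E); last exact: ltry.
  apply/ess_supP; apply: aeW => x.
  by rewrite lee_fin rnormZ ler_wpM2r// rnorm_ge0.
move=> f; have [q [qs q_cvg qf]] := L1_simple_approx f.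
pose s n x := (q n x * pair_scalar (p n x)) *: y.
pose w (z : K * (R * R)) := (z.1 * pair_scalar z.2) *: y.
have s_simple n : vector_simple (s n).
  apply/vector_simpleP; have [r pr] := ps n; have [r' qr] := qs n.
  by eexists; exact: (simple_map_comp w (simple_map_pair qr pr)).
split.
  exists s => //; apply: aeW => x; rewrite scalerA; apply: cvgZr_tmp.
  by apply: cvgM; [exact: q_cvg|exact: p_cvg].
pose F n := L1_class mu (q n).
(* From f g - q p = (f - q) g + q (g - p), with |g| <= 2N, |g - p| <= 2/(n+1), and |q| <= |f| + |f -
   q| in norm. *)
pose b n := 2 * N * rnorm (f - F n) + 2 * harmonic n * (rnorm f + rnorm (f - F n)).
have b_cvg : b n @[n --> \oo] --> 0.
  rewrite (_ : 0 = 2 * N * 0 + 2 * 0 * (rnorm f + 0)); last by rewrite !mulr0 mul0r addr0.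
  apply: cvgD; first by apply: cvgM; [exact: cvg_cst|exact: qf].
  apply: cvgM; last by apply: cvgD; [exact: cvg_cst|exact: qf].
  by apply: cvgM; [exact: cvg_cst|exact: cvg_harmonic].
have Fn n : rnorm (F n) <= rnorm f + rnorm (f - F n).
  by rewrite -[F n in leLHS](subrK f) [leRHS]addrC (rdistC f) rnormD.
have h0 n : 0 <= harmonic n :> R by rewrite invr_ge0.
exists s; split => //.
  have byn n : (0 <= \int[mu]_x (rnorm (f x *: (g x *: y) - s n x))%:E <=
      (rnorm y * b n)%:E)%E.
    rewrite integral_ge0/=; last by move=> x _; rewrite lee_fin rnorm_ge0.
    have q_int : q n \in integrable_scalar mu.
      by have [r qr] := qs n; exact: simple_map_integrable (id : K -> K) qr.
    have fq_int : (fun x => f x - q n x) \in integrable_scalar mu.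
      exact: (rpredB (L1_repr_integrable f) q_int).
    have fqE : ((f - F n : L1) : T -> K) = (fun x => f x - q n x) %[ae mu].
      apply: filterS2 (L1_reprB f (F n)) (L1_classP q_int).
      by move=> x -> // qx _; rewrite qx.
    have m1 := measurable_rnorm (MkL1fun fq_int).
    have m2 := measurable_rnorm (MkL1fun q_int).
    apply: (@le_trans _ _ (\int[mu]_x ((rnorm y * (2 * N))%:E * (rnorm (f x - q n x))%:E +
        (rnorm y * (2 * harmonic n))%:E * (rnorm (q n x))%:E))%E).
      (* Measurability is established only for the majorant, so the comparison is between suprema
         over simple functions. *)
      apply: ge0_le_lower_integral => x; first by rewrite lee_fin rnorm_ge0.
      rewrite -!EFinM -EFinD lee_fin /s scalerA -scalerBl rnormZ mulrC.
      rewrite -!mulrA -mulrDr ler_wpM2l ?rnorm_ge0//.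
      rewrite (_ : _ - _ = (f x - q n x) * g x + q n x * (g x - pair_scalar (p n x))); last first.
        by rewrite mulrBl mulrBr addrA subrK.
      apply: le_trans (rnormD _ _) _; rewrite !rnormM lerD//.
        by rewrite [leRHS]mulrA [leRHS]mulrC ler_wpM2l ?rnorm_ge0.
      by rewrite [leRHS]mulrA [leRHS]mulrC ler_wpM2l ?rnorm_ge0.
    have c0 a : 0 <= a -> (0 <= (rnorm y * (2 * a))%:E)%E.
      by move=> a0; rewrite lee_fin !mulr_ge0// rnorm_ge0.
    rewrite ge0_integralD//; last 4 first.
    - by move=> x _; rewrite mule_ge0 ?c0// lee_fin rnorm_ge0.
    - by apply: measurable_funeM; exact/measurable_EFinP.
    - by move=> x _; rewrite mule_ge0 ?c0// lee_fin rnorm_ge0.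
    - by apply: measurable_funeM; exact/measurable_EFinP.
    rewrite !ge0_integralZl ?c0//; last 4 first.
    - exact/measurable_EFinP.
    - by move=> x _; rewrite lee_fin rnorm_ge0.
    - exact/measurable_EFinP.
    - by move=> x _; rewrite lee_fin rnorm_ge0.
    rewrite -(rnorm_L1_ae fq_int fqE) -(rnorm_L1_ae q_int (L1_classP q_int)).
    rewrite -!EFinM -EFinD lee_fin -!mulrA -mulrDr ler_wpM2l ?rnorm_ge0//.
    rewrite /b -!mulrA lerD2l; apply: ler_wpM2l => //.
    by apply: ler_wpM2l; [exact: h0|exact: Fn].
  apply: (squeeze_cvge (nearW _ byn) (cvg_cst 0%E)).
  apply: cvg_EFin; first exact: nearW.
  by rewrite -(mulr0 (rnorm y)); apply: cvgM; [exact: cvg_cst|exact: b_cvg].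
(* The first term replaces f by [F n] under S; the second compares [S (F n)] with the simple
   integral fibre by fibre. *)
pose e n := M * rnorm (f - F n) + rnorm y * b n.
apply: (@rnorm_cvg0_le _ _ _ _ _ e) => [n|]; last first.
  rewrite (_ : 0 = M * 0 + rnorm y * 0); last by rewrite !mulr0 addr0.
  by apply: cvgD; apply: cvgM; [exact: cvg_cst|exact: qf|exact: cvg_cst|exact: b_cvg].
apply: le_trans (rdistD (S (F n)) _ _) _; apply: lerD.
  by rewrite -linearB.
have [r pr] := ps n; have [r' qr] := qs n.
have qpr := simple_map_pair qr pr; set qp := (fun x => (_, _)) in qpr.
rewrite (simple_integral_comp mu w qpr).
rewrite /F (L1_class_simple mu fst qpr) raddf_sum -sumrB/=.
apply: le_trans (rnorm_sum _ _) _.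
apply: (@le_trans _ _ (rnorm y * (2 * harmonic n * rnorm (F n)))); last first.
  rewrite ler_wpM2l ?rnorm_ge0// /b; apply: le_trans (ler_wpM2l _ (Fn n)) _.
    by rewrite mulr_ge0.
  by rewrite lerDr !mulr_ge0// rnorm_ge0.
rewrite {1}/F (rnorm_L1_simple mu fst qpr) !mulr_sumr; apply: ler_sum => z _.
rewrite linearZ/= Sphi /w !scalerA -scalerBl rnormZ mulrC ler_wpM2l ?rnorm_ge0//.
rewrite mulrCA [of_real _ * _]mulrC -mulrBr rnormM.
rewrite mulrA [leRHS]mulrC ler_wpM2l ?rnorm_ge0//.
apply: pphi => [|x]; first by case: qpr.
by rewrite /= /qp => <-.
Qed.

End rank_one.

Theorem theorem4p17 (R : realType) (k : scalar_kind)
    (d : measure_display) (Omega : measurableType d)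
    (mu : probability Omega R)
    (Y : completeNormedModType (scalar_field R k))
    (G : {linear L1 k mu -> Y}) (G_continuous : continuous G)
    (G_norm1 : opnorm G = 1) :
  [<-> alt_Daugavet_property G ;
       forall A : set Omega, measurable A -> (0 < mu A)%E ->
         spear_set (G @` Gamma k mu A) ;
       forall T : {linear L1 k mu -> Y}, continuous T -> representable T ->
         alt_Daugavet_eq G T].
Proof.
tfae.
- by move=> GD A mA A0; exact: alt_Daugavet_spear.
- by move=> Gs T cT rT; exact: spear_representable.
- move=> GR T cT [y y0 rT]; apply: GR => //.
  have Ty f : exists a, T f = a *: y.
    have : range T (T f) by exists f.
    by rewrite rT => -[a _ <-]; exists a.
  have [phi [Tphi phiP]] := rank_one_functional y0 Ty.
  apply: (functional_representable cT y0 Tphi) => f f'.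
  by rewrite -[f]scale1r phiP mul1r scale1r.
Qed.
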